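(* Let $a<b$ be real numbers, $f\in C[a,b]$, $\alpha\in(0,1)$, and $c_\alpha=\frac{\sin(\pi\alpha)}{\pi}$. Let $\psi:\Omega\to(0,\infty)$ be an admissible transformation and let $0<h<b-a$. Then, for every $t\in[a+h,b]$, the history part $H_{a,h}^\alpha f(t)$ of the Riemann-Liouville integral of order $\alpha$ of $f$ satisfies $$H_{a,h}^\alpha f(t)=\int_\Omega \mu(t,h,r)\,dr,$$ where $$\mu(t,h,r)=c_\alpha\,\psi'(r)\,(\psi(r))^{-\alpha}\int_a^{t-h} e^{-(t-\tau)\psi(r)}f(\tau)\,d\tau .$$ Moreover, $\mu$ has the following properties. (a) For every $r\in\Omega$, the function $\mu(\cdot,h,r)$ is the unique solution on $[a+h,b]$ of the first order differential equation $$\frac{\partial\mu}{\partial t}(t,h,r)=-\psi(r)\mu(t,h,r)+c_\alpha\psi'(r)(\psi(r))^{-\alpha}e^{-h\psi(r)}f(t-h)$$ subject to the initial condition $\mu(a+h,h,r)=0$. (b) If $\psi\in C^k(\Omega)$ for some $k\in\mathbb{N}$ then, for every $t\in[a+h,b]$, $\mu(t,h,\cdot)\in C^{k-1}(\Omega)$. (c) If $\psi\in C^\infty(\Omega)$ then, for every $t\in[a+h,b]$, $\mu(t,h,\cdot)\in C^\infty(\Omega)$. (d) If $f\in C^\ell[a,b]$ for some $\ell\in\mathbb{N}_0$ then, for every $r\in\Omega$, $\mu(\cdot,h,r)\in C^{\ell+1}[a+h,b]$. (e) For every fixed $t\in[a+h,b]$ there exist constants $C_1,C_2>0$ such that $$|\mu(t,h,r)|\le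 C_1\,\psi'(r)(\psi(r))^{-\alpha-1}e^{-h\psi(r)}\quad\text{for } r\to\sup\Omega$$ (i.e. for all $r\in\Omega$ sufficiently close to $\sup\Omega$) and $$|\mu(t,h,r)|\le C_2\,\psi'(r)(\psi(r))^{-\alpha}\quad\text{for } r\to\inf\Omega$$ (i.e. for all $r\in\Omega$ sufficiently close to $\inf\Omega$).
   Context: Admissible transformation: let $\Omega$ be a non-empty open interval (possibly unbounded). A strictly monotonically increasing function $\psi:\Omega\to(0,\infty)$ is called an admissible transformation if $\psi\in C^1(\Omega)$, $\lim_{r\to\inf\Omega}\psi(r)=0$ and $\lim_{r\to\sup\Omega}\psi(r)=+\infty$. History part: for $f\in C[a,b]$, $\alpha\in(0,1)$, $h>0$ and $t\in[a+h,b]$, the history part of the Riemann-Liouville integral $I_a^\alpha f(t)=\frac{1}{\Gamma(\alpha)}\int_a^t(t-\tau)^{\alpha-1}f(\tau)\,d\tau$ is $$H_{a,h}^\alpha f(t)=\frac{1}{\Gamma(\alpha)}\int_a^{t-h}(t-\tau)^{\alpha-1}f(\tau)\,d\tau .$$ Here $\mathbb{N}=\{1,2,\dots\}$ and $\mathbb{N}_0=\{0,1,2,\dots\}$. *)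

(* Defs.v *)
From HB Require Import structures.
From mathcomp Require Import all_boot all_order all_algebra.
From mathcomp Require Import all_classical all_reals all_analysis.
Import Order.TTheory GRing.Theory Num.Theory.
Import numFieldNormedType.Exports.

Set Implicit Arguments.
Unset Strict Implicit.
Unset Printing Implicit Defensive.

Local Open Scope classical_set_scope.
Local Open Scope ring_scope.

(* The filter "r -> e with r in Omega", for an extended real e; it is used with
   e = inf Omega and e = sup Omega, which may be infinite. *)
Definition toward (R : realType) (Omega : set R) (e : \bar R) : set_system R :=
  filter_from (nbhs e) (fun U => Omega `&` EFin @^-1` U).

Definition inf_end (R : realType) (Omega : set R) : \bar R :=
  ereal_inf (EFin @` Omega).

Definition sup_end (R : realType) (Omega : set R) : \bar R :=
  ereal_sup (EFin @` Omega).

Global Instance toward_filter (R : realType) (Omega : set R) (e : \bar R) :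
  Filter (toward Omega e).
Proof.
apply: filter_from_filter; first by exists setT; exact: filterT.
move=> U V Ue Ve; exists (U `&` V); first exact: filterI.
by move=> r /= [Or [Ur Vr]].
Qed.

(* f is differentiable on D with derivative g, the difference quotients being
   taken inside D: one-sided derivatives at the endpoints of a segment, the
   usual derivative on an open set (see [derivative_on_open]). *)
Definition derivative_on (R : realType) (D : set R) (f g : R -> R) : Prop :=
  forall x, D x -> (f y - f x) / (y - x) @[y --> within D x^'] --> g x.

(* C^n(D).  When every point of D is a limit point of D (e.g. D an interval
   with more than one point), g is determined on D by f. *)
Fixpoint Cn (R : realType) (n : nat) (D : set R) (f : R -> R) : Prop :=
  match n with
  | 0%N => {within D, continuous f}
  | m.+1 => exists2 g, derivative_on D f g & Cn m D g
  end.

Definition Cinfty (R : realType) (D : set R) (f : R -> R) : Prop :=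
  forall n, Cn n D f.

Lemma derivative_on_open (R : realType) (D : set R) (f g : R -> R) :
  open D ->
  derivative_on D f g <-> (forall x, D x -> is_derive x 1 f (g x)).
Proof.
move=> Dopen.
suff H x l : D x ->
    ((f y - f x) / (y - x) @[y --> within D x^'] --> l) <-> is_derive x 1 f l.
  by split=> df x Dx; apply/H => //; exact: df.
move=> Dx.
have E : ((f y - f x) / (y - x) @[y --> within D x^'] --> l) <->
    (h^-1 *: ((f \o shift x) (h *: 1) - f x) @[h --> 0^'] --> l).
  have ND : \forall h \near (0 : R), D (x + h).
    by apply: (proj1 (@nbhs0P R R^o D x)); apply: open_nbhs_nbhs; split.
  split=> /cvgrPdist_lt fl; apply/cvgrPdist_lt => e /fl.
    rewrite !near_withinE => fe0; have fe := proj1 (@nbhs0P R R^o _ x) fe0.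
    apply: filterS2 ND fe => h Dxh fe h0; move: fe.
    have -> : x + h - x = h by rewrite addrAC subrr add0r.
    rewrite /GRing.scale/= mulr1 mulrC [h + x]addrC; apply => //.
    by rewrite -subr_eq0 addrAC subrr add0r.
  rewrite !near_withinE => fe; apply: (proj2 (@nbhs0P R R^o _ x)).
  apply: filterS fe => h fe xh Dxh.
  have h0 : h != 0 by apply: contra xh => /eqP ->; rewrite addr0.
  have -> : x + h - x = h by rewrite addrAC subrr add0r.
  by move: (fe h0); rewrite /GRing.scale/= mulr1 mulrC [h + x]addrC.
rewrite E; split=> [fl|[dfx <-] //].
by apply: DeriveDef; [exact: cvgP fl | exact: cvg_lim fl].
Qed.

Definition open_interval (R : realType) (Omega : set R) : Prop :=
  [/\ Omega !=set0, open Omega & is_interval Omega].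

Record admissible (R : realType) (Omega : set R) (psi : R -> R) : Prop :=
  Admissible {
    admissible_gt0 : {in Omega, forall r, 0 < psi r};
    admissible_incr : {in Omega &, {homo psi : r s / r < s}};
    admissible_C1 : Cn 1 Omega psi;
    admissible_inf : psi r @[r --> toward Omega (inf_end Omega)] --> (0 : R);
    admissible_sup : psi r @[r --> toward Omega (sup_end Omega)] --> +oo }.

(* Euler's Gamma function, for x > 0. *)
Definition Gamma (R : realType) (x : R) : R :=
  \int[@lebesgue_measure R]_(s in `]0, +oo[) (s `^ (x - 1) * expR (- s)).

Definition history (R : realType) (a : R) (f : R -> R) (alpha h t : R) : R :=
  (Gamma alpha)^-1 *
  \int[@lebesgue_measure R]_(tau in `[a, t - h])
    ((t - tau) `^ (alpha - 1) * f tau).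

Definition c_ (R : realType) (alpha : R) : R := sin (pi * alpha) / pi.

Definition mu_ (R : realType) (a : R) (f : R -> R) (alpha : R) (psi : R -> R)
    (t h r : R) : R :=
  c_ alpha * derive1 psi r * psi r `^ (- alpha) *
  \int[@lebesgue_measure R]_(tau in `[a, t - h])
    (expR (- (t - tau) * psi r) * f tau).

Definition solves_on (R : realType) (D : set R) (F : R -> R -> R) (y : R -> R)
  : Prop := derivative_on D y (fun t => F t (y t)).

(* Main.v *)
(* The representation rests on
     (t - tau)^(alpha - 1) Gamma(1 - alpha) = \int_0^oo s^(-alpha) e^(-(t - tau) s) ds,
   the substitution s = psi r, and Fubini; the constant c_alpha is
   1 / (Gamma(alpha) Gamma(1 - alpha)) by Euler's reflection formula.

   The reflection formula is obtained by real methods.  Tonelli and u = e^x give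
     Gamma(c) Gamma(1 - c) = \int_0^oo (e^(-c x) + e^(-(1 - c) x)) / (1 + e^(-x)) dx,
   and expanding in powers of e^(-x) shows that this is
     \sum_k (-1)^k (1 / (k + c) + 1 / (k + 1 - c)).
   Times sin (pi c), the n-th partial sum is the integral over [0, pi] of
   cos ((c - 1/2) x) sin (n x) / sin (x/2).  Subtracting the kernel for c = 0, whose
   integral is pi, leaves a bounded function times sin (n x), so that the limit is pi.

   The regularity in t comes from
     mu(t) = K e^(-t psi) \int_a^(t - h) e^(tau psi) f(tau) dtau,
   and the regularity in r from writing mu as psi' times a smooth function of psi,
   obtained by differentiating under the integral sign. *)
Require Import Defs.
From mathcomp Require Import all_boot all_order all_algebra.
From mathcomp Require Import all_classical all_reals all_analysis.
From mathcomp Require Import measurable_realfun ring lra.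
Import Order.TTheory GRing.Theory Num.Theory.
Import numFieldNormedType.Exports.
Set Implicit Arguments.
Unset Strict Implicit.
Unset Printing Implicit Defensive.
Local Open Scope classical_set_scope.
Local Open Scope ring_scope.

(** The Gamma integrals are never shown to be finite by estimates. They stay extended reals until
    the reflection formula gives their product a finite positive value, which forces each factor to
    be finite and positive. That finiteness supplies the absolute integrability required by Fubini.
    The other half of it comes from h > 0, which keeps tau at distance at least h from t, so that
    the singular kernel (t - tau)^(alpha - 1) is continuous on the whole segment of integration.

    The limits of psi at the two ends of Omega serve to make psi reach every positive value. Changes
    of variable are then made on segments exhausting Omega and extended by monotone convergence.

    In the reflection formula the limit is taken with explicit errors: a term of order 1/n from
    Riemann-Lebesgue away from 0, a term 2e from the piece [0, e] where the denominator sin (x/2)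
    degenerates, and a term of order 1/n from the remainder of the alternating series. *)

(** * Derivatives within a set and the classes C^n *)

Section derivative_on_theory.
Context {R : realType}.
Implicit Types (D E : set R) (f g F G : R -> R).

(* Caratheodory's characterization, which turns the algebra of derivatives into
   the algebra of limits. *)
Lemma derivative_onP D f g : derivative_on D f g <->
  forall x, D x -> exists2 phi : R -> R,
    (forall y, f y - f x = phi y * (y - x)) &
    phi y @[y --> within D (nbhs x)] --> g x.
Proof.
split=> [df x Dx|H x Dx].
  exists (fun y => if y == x then g x else (f y - f x) / (y - x)).
    move=> y; case: eqP => [->|/eqP yx]; first by rewrite !subrr mulr0.
    by rewrite divfK// subr_eq0.
  apply/cvgrPdist_lt => e e0.
  have /cvgrPdist_lt/(_ _ e0) := df x Dx.
  rewrite !near_withinE => H; apply: filterS H => y H Dy.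
  by case: eqP => [_|/eqP yx]; [rewrite subrr normr0|exact: H].
have [phi fphi cphi] := H x Dx.
apply/cvgrPdist_lt => e e0; have /cvgrPdist_lt/(_ _ e0) := cphi.
rewrite !near_withinE => {}H; apply: filterS H => y H yx Dy.
by rewrite fphi mulfK ?subr_eq0//; exact: H.
Qed.

Lemma derivative_on_continuous D f g :
  derivative_on D f g -> {within D, continuous f}.
Proof.
move=> /derivative_onP df; apply/subspace_continuousP => x Dx.
have [phi fphi cphi] := df x Dx.
have -> : f = (fun y => f x + phi y * (y - x)).
  by apply/funext => y; rewrite -fphi addrC subrK.
rewrite [X in _ --> X](_ : _ = f x + g x * (x - x)); last first.
  by rewrite /from_subspace/= subrr !mulr0.
apply: cvgD; first exact: cvg_cst.
apply: cvgM => //; apply: cvgB; last exact: cvg_cst.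
exact: cvg_within.
Qed.

Lemma derivative_onS D E f g :
  D `<=` E -> derivative_on E f g -> derivative_on D f g.
Proof.
move=> DE df x Dx; apply: cvg_trans (df x (DE _ Dx)).
apply: cvg_app => A; rewrite !nbhs_nearE /= !near_withinE => H.
by apply: filterS H => y H yx /DE; exact: H.
Qed.

Lemma eq_derivative_on D f f1 g g1 : (forall x, D x -> f x = f1 x) ->
  (forall x, D x -> g x = g1 x) ->
  derivative_on D f g -> derivative_on D f1 g1.
Proof.
move=> ff1 gg1 df x Dx; rewrite -gg1//.
apply: cvg_trans (df x Dx); apply: near_eq_cvg.
by rewrite !near_withinE; near=> y => yx Dy; rewrite -!ff1.
Unshelve. all: by end_near. Qed.

Lemma derivative_on_cst D (c : R) : derivative_on D (cst c) (cst 0).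
Proof.
apply/derivative_onP => x Dx; exists (cst 0).
  by move=> y; rewrite subrr mul0r.
exact: cvg_cst.
Qed.

Lemma derivative_on_id D : derivative_on D id (cst 1).
Proof.
apply/derivative_onP => x Dx; exists (cst 1).
  by move=> y; rewrite mul1r.
exact: cvg_cst.
Qed.

Lemma derivative_onD D f f1 g g1 :
  derivative_on D f g -> derivative_on D f1 g1 ->
  derivative_on D (fun x => f x + f1 x) (fun x => g x + g1 x).
Proof.
move=> /derivative_onP df /derivative_onP dg; apply/derivative_onP => x Dx.
have [p fp cp] := df x Dx; have [q fq cq] := dg x Dx.
exists (fun y => p y + q y); last exact: cvgD.
by move=> y; rewrite mulrDl -fp -fq; ring.
Qed.

Lemma derivative_onM D f f1 g g1 :
  derivative_on D f g -> derivative_on D f1 g1 ->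
  derivative_on D (fun x => f x * f1 x) (fun x => g x * f1 x + f x * g1 x).
Proof.
move=> df dg; have /subspace_continuousP cf1 := derivative_on_continuous dg.
move/derivative_onP: df => df; move/derivative_onP: dg => dg.
apply/derivative_onP => x Dx.
have [p fp cp] := df x Dx; have [q fq cq] := dg x Dx.
exists (fun y => p y * f1 y + f x * q y).
  by move=> y; rewrite mulrDl -(mulrA (f x)) -fq (mulrAC (p y)) -fp; ring.
apply: cvgD; first by apply: cvgM => //; exact: cf1.
by apply: cvgM => //; exact: cvg_cst.
Qed.

Lemma derivative_onZ D (c : R) f g : derivative_on D f g ->
  derivative_on D (fun x => c * f x) (fun x => c * g x).
Proof.
move=> df.
apply: (@eq_derivative_on D (fun x => cst c x * f x) _
  (fun x => cst 0 x * f x + cst c x * g x)) => //.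
  by move=> x Dx /=; rewrite mul0r add0r.
exact: derivative_onM (derivative_on_cst c) df.
Qed.

Lemma cvg_within_within D E f x : (forall y, D y -> E (f y)) ->
  f y @[y --> within D (nbhs x)] --> f x ->
  f y @[y --> within D (nbhs x)] --> within E (nbhs (f x)).
Proof.
move=> DE cf A EA; have H : \forall y \near x, D y -> E (f y) -> A (f y) := cf _ EA.
by apply: filterS H => y H Dy; exact/H/DE.
Qed.

(** Multiplying the two Caratheodory factors involves no division by [f y - f x], so points [y] with
    [f y = f x] need no separate case. *)
Lemma derivative_on_comp D E F G f g :
  (forall x, D x -> E (f x)) ->
  derivative_on E F G -> derivative_on D f g ->
  derivative_on D (fun x => F (f x)) (fun x => G (f x) * g x).
Proof.
move=> DE dF df; have /subspace_continuousP cf := derivative_on_continuous df.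
move/derivative_onP: df => df; move/derivative_onP: dF => dF.
apply/derivative_onP => x Dx.
have [p fp cp] := df x Dx; have [q fq cq] := dF _ (DE _ Dx).
exists (fun y => q (f y) * p y).
  by move=> y; rewrite fq fp; ring.
apply: cvgM => //; apply: cvg_comp cq.
exact: cvg_within_within (cf x Dx).
Qed.

Lemma derivative_on_derive1 D f g x : open D -> derivative_on D f g -> D x ->
  derive1 f x = g x.
Proof.
move=> oD /(derivative_on_open _ _ oD) df Dx.
by rewrite derive1E; have := df x Dx => ?; rewrite derive_val.
Qed.

Lemma within_continuous_norm D f : {within D, continuous f} ->
  {within D, continuous (fun x => `|f x|)}.
Proof. by move=> cf x; apply: continuous_comp; [exact: cf|exact: norm_continuous]. Qed.

Lemma CnS n D f : Cn n.+1 D f -> Cn n D f.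
Proof.
elim: n f => [|n IHn] f /= [g dfg Cg]; first exact: derivative_on_continuous dfg.
by exists g => //; exact: IHn.
Qed.

Lemma Cn_continuous n D f : Cn n D f -> {within D, continuous f}.
Proof. by elim: n f => // n IHn f /CnS/IHn. Qed.

Lemma eq_Cn n D f g : (forall x, D x -> f x = g x) -> Cn n D f -> Cn n D g.
Proof.
move=> fg; case: n => [|n] /=.
  move=> /subspace_continuousP cf; apply/subspace_continuousP => x Dx.
  rewrite -[from_subspace D g x](fg x Dx).
  apply: cvg_trans (cf x Dx); apply: near_eq_cvg.
  by rewrite !near_withinE; near=> y => Dy; exact: fg.
by move=> [f' df Cf']; exists f' => //; apply: eq_derivative_on df.
Unshelve. all: by end_near. Qed.

Lemma Cn_cst n D (c : R) : Cn n D (cst c).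
Proof.
elim: n c => [|n IHn] c /=; first exact: continuous_subspaceT (@cst_continuous _ _ c).
by exists (cst 0) => //; exact: derivative_on_cst.
Qed.

Lemma Cn_D n D f g : Cn n D f -> Cn n D g -> Cn n D (fun x => f x + g x).
Proof.
elim: n f g => [|n IHn] f g /=.
  by move=> cf cg x; apply: continuousD; [exact: cf|exact: cg].
move=> [f' df Cf] [g' dg Cg]; exists (fun x => f' x + g' x).
  exact: derivative_onD.
exact: IHn.
Qed.

Lemma Cn_M n D f g : Cn n D f -> Cn n D g -> Cn n D (fun x => f x * g x).
Proof.
elim: n f g => [|n IHn] f g.
  by move=> /= cf cg x; apply: continuousM; [exact: cf|exact: cg].
move=> Cf Cg; have Cf1 := CnS Cf; have Cg1 := CnS Cg.
move: Cf Cg => /= [f' df Cf] [g' dg Cg].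
exists (fun x => f' x * g x + f x * g' x); first exact: derivative_onM.
by apply: Cn_D; exact: IHn.
Qed.

Lemma Cn_Z n D (c : R) f : Cn n D f -> Cn n D (fun x => c * f x).
Proof. exact: Cn_M (Cn_cst n D c). Qed.

Lemma Cn_id n D : Cn n D id.
Proof.
case: n => [|n] /=; first by apply: continuous_subspaceT => x; exact: cvg_id.
by exists (cst 1); [exact: derivative_on_id|exact: Cn_cst].
Qed.

(** The outer function is given with the whole sequence of its derivatives: the chain rule turns
    [F m] into [F m.+1], so the induction on [n] must cover every [m] at once. *)
Lemma Cn_comp n D E (F : nat -> R -> R) f :
  (forall x, D x -> E (f x)) ->
  (forall m, derivative_on E (F m) (F m.+1)) ->
  Cn n D f -> forall m, Cn n D (fun x => F m (f x)).
Proof.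
move=> DE dF; elim: n f DE => [|n IHn] f DE.
  move=> /subspace_continuousP cf m; apply/subspace_continuousP => x Dx.
  have /subspace_continuousP cF := derivative_on_continuous (dF m).
  apply: cvg_comp (cF _ (DE _ Dx)).
  exact: cvg_within_within (cf x Dx).
move=> Cf m; have Cf1 := CnS Cf; case: Cf => g df Cg.
exists (fun x => F m.+1 (f x) * g x); first exact: derivative_on_comp DE _ _.
by apply: Cn_M => //; exact: IHn.
Qed.

Lemma Cn_derive1 n D f : open D -> Cn n.+1 D f -> Cn n D (derive1 f).
Proof.
move=> oD [g df Cg]; apply: eq_Cn Cg => x Dx.
by rewrite (derivative_on_derive1 oD df Dx).
Qed.

End derivative_on_theory.

(** * Primitives and linear differential equations *)

Section primitive.
Context {R : realType}.
Implicit Types (a b h s : R) (f g y z : R -> R).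
Notation leb := (@lebesgue_measure R).

(* A continuous extension of [f] from [a, b] to the line: the two-sided results on
   primitives then give the one-sided derivatives at [a] and [b]. *)
Definition clamp a b f : R -> R := fun x => f (Num.max a (Num.min x b)).

Lemma continuous_clamp a b f : a <= b -> {within `[a, b], continuous f} ->
  continuous (clamp a b f).
Proof.
move=> ab /subspace_continuousP cf x.
pose c (y : R) := Num.max a (Num.min y b).
have cc : {for x, continuous c}.
  apply: continuous_max; first exact: cvg_cst.
  by apply: continuous_min; [exact: cvg_id|exact: cvg_cst].
have cab (u : R) : c u \in `[a, b].
  by rewrite /c in_itv /= le_max lexx /= ge_max ab ge_min lexx orbT.
have H : f y @[y --> within `[a, b] (nbhs (c x))] --> f (c x) by exact: cf (cab x).
apply: cvg_comp H => A cA.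
have H1 : \forall y \near x, c y \in `[a, b] -> A (c y) := cc _ cA.
by apply: filterS H1 => y; apply; exact: cab.
Qed.

Lemma clampE a b f x : x \in `[a, b] -> clamp a b f x = f x.
Proof.
rewrite in_itv /= => /andP[ax xb]; rewrite /clamp.
by rewrite (min_idPl xb) (max_idPr ax).
Qed.

Lemma continuous_integrable_itv a b f : {within `[a, b], continuous f} ->
  leb.-integrable `[a, b] (EFin \o f).
Proof. by move=> cf; apply: continuous_compact_integrable => //; exact: segment_compact. Qed.

Lemma is_derive_primitive g a x : continuous g -> a < x ->
  is_derive x (1 : R) (fun x => \int[leb]_(t in `[a, x]) g t) (g x).
Proof.
move=> cg ax.
have xx1 : x < x + 1 by rewrite ltrDl.
have ig : leb.-integrable `[a, x + 1] (EFin \o g).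
  by apply: continuous_integrable_itv; exact: continuous_subspaceT.
have [dF F'E] := continuous_FTC1_closed xx1 ig ax (cg x).
by apply: DeriveDef; [exact: dF|rewrite -derive1E; exact: F'E].
Qed.

Lemma Rintegral_itv_split g a b c : a <= b -> b <= c -> continuous g ->
  \int[leb]_(t in `[a, c]) g t =
  \int[leb]_(t in `[a, b]) g t + \int[leb]_(t in `[b, c]) g t.
Proof.
move=> ab bc cg.
have ig u v : leb.-integrable `[u, v] (EFin \o g).
  by apply: continuous_integrable_itv; exact: continuous_subspaceT.
have := @Rintegral_itvB _ g (BLeft a) (BRight c) b (ig _ _).
rewrite !bnd_simp => /(_ ab bc) => E.
rewrite -[X in _ + X]Rintegral_itv_obnd_cbnd; first by rewrite -E addrC subrK.
by apply: integrableS (ig b c) => //; apply: subset_itvr; rewrite bnd_simp.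
Qed.

Lemma derivative_on_primitive a b f : a <= b -> {within `[a, b], continuous f} ->
  derivative_on `[a, b] (fun x => \int[leb]_(t in `[a, x]) f t) f.
Proof.
move=> ab cf; set g := clamp a b f.
have cg : continuous g by exact: continuous_clamp.
(* Starting at [a - 1] makes [a] an interior point, so the two-sided derivative exists on the whole
   segment; the constant [Phi a] is subtracted afterwards. *)
pose Phi x := \int[leb]_(t in `[(a - 1), x]) g t.
have dPhi : derivative_on `](a - 1), +oo[ Phi g.
  apply/derivative_on_open; first exact: interval_open.
  move=> x /=; rewrite in_itv/= andbT => ax; exact: is_derive_primitive.
apply: (@eq_derivative_on _ _ (fun x => Phi x + cst (- Phi a) x) _
  (fun x => g x + cst 0 x)).
- move=> x /= xab; rewrite /Phi (@Rintegral_itv_split g (a - 1) a x)//.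
  + rewrite addrAC subrr add0r; apply: eq_Rintegral => t; rewrite inE /= => tax.
    apply: clampE; move: xab tax; rewrite !in_itv/= => /andP[? xb] /andP[-> tx] /=.
    exact: le_trans xb.
  + by rewrite lerBlDr lerDl.
  + by move: xab; rewrite in_itv/= => /andP[].
- by move=> x /= xab; rewrite addr0; exact: clampE.
- apply: derivative_onD; last exact: derivative_on_cst.
  apply: derivative_onS dPhi => x /=; rewrite !in_itv/= andbT => /andP[ax _].
  by apply: lt_le_trans ax; rewrite ltrBlDr ltrDl.
Qed.

Lemma derivative_on0_cst a b w : derivative_on `[a, b] w (cst 0) ->
  {in `[a, b], forall t, w t = w a}.
Proof.
move=> dw t; rewrite in_itv/= => /andP[at_ tb].
have [] := @MVT_segment R w (cst 0) a t at_.
- move=> x xat.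
  have /(derivative_on_open _ _ _).1 : derivative_on `]a, t[ w (cst 0).
    apply: derivative_onS dw => y /=; rewrite !in_itv/= => /andP[ay yt].
    by rewrite (ltW ay)/= (le_trans (ltW yt)).
  by apply => //; exact: interval_open.
- apply: continuous_subspaceW (derivative_on_continuous dw).
  by apply: subset_itvl; rewrite bnd_simp.
- by move=> c _ /eqP; rewrite mul0r subr_eq0 => /eqP.
Qed.

Lemma is_derive_expM (k x : R) :
  is_derive x 1 (fun t => expR (k * t)) (k * expR (k * x)).
Proof. by apply: trigger_derive; rewrite /GRing.scale/= mulr1 mulrC. Qed.

Lemma derivative_on_expM D (k : R) :
  derivative_on D (fun t => expR (k * t)) (fun t => k * expR (k * t)).
Proof.
apply: derivative_onS (subsetT D) _; apply/derivative_on_open; first exact: openT.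
by move=> x _; exact: is_derive_expM.
Qed.

(** Integrating factor: exp(-k t) z(t) has derivative zero, hence keeps its initial value 0, and the
    exponential never vanishes. *)
Lemma linear_ode_unique a b (k : R) z : derivative_on `[a, b] z (fun t => k * z t) ->
  z a = 0 -> {in `[a, b], forall t, z t = 0}.
Proof.
move=> dz za t tab.
have dw : derivative_on `[a, b] (fun t => expR (- k * t) * z t) (cst 0).
  apply: (@eq_derivative_on _ _ (fun t => expR (- k * t) * z t) _
    (fun t => - k * expR (- k * t) * z t + expR (- k * t) * (k * z t))) => //.
    by move=> x _; rewrite /cst /=; ring.
  exact: (derivative_onM (@derivative_on_expM _ (- k)) dz).
have := derivative_on0_cst dw tab; rewrite /= za mulr0 => /eqP.
by rewrite mulf_eq0 gt_eqF ?expR_gt0//= => /eqP.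
Qed.

End primitive.

(** * Regularity of mu in time *)

Section memory_in_time.
Context {R : realType}.
Variables (a b : R) (f : R -> R) (alpha : R) (psi : R -> R) (h : R).
Hypotheses (cf : {within `[a, b], continuous f}) (h0 : 0 < h) (hab : h < b - a).
Notation leb := (@lebesgue_measure R).
Notation mu := (mu_ a f alpha psi).

Lemma shift_itv t : t \in `[a + h, b] -> t - h \in `[a, b].
Proof.
rewrite !in_itv/= => /andP[aht tb]; rewrite lerBrDr aht/=.
by rewrite lerBlDr (le_trans tb)// lerDl ltW.
Qed.

Lemma continuous_expRM_within (k : R) :
  {within `[a, b], continuous (fun tau => expR (k * tau) * f tau)}.
Proof.
apply: (@Cn_M _ 0 `[a, b] (fun tau => expR (k * tau))) => //.
exact: (derivative_on_continuous (@derivative_on_expM _ _ k)).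
Qed.

Lemma muE t r : t \in `[a + h, b] -> mu t h r =
  c_ alpha * derive1 psi r * psi r `^ (- alpha) * (expR (- psi r * t) *
   \int[leb]_(tau in `[a, t - h]) (expR (psi r * tau) * f tau)).
Proof.
move=> /shift_itv; rewrite in_itv/= => /andP[ath thb].
rewrite /mu_; congr (_ * _); rewrite -RintegralZl//.
  by apply: eq_Rintegral => tau _; rewrite mulrA -expRD; congr (expR _ * _); ring.
apply: continuous_integrable_itv.
apply: continuous_subspaceW (continuous_expRM_within (k := psi r)).
by apply: subset_itvl; rewrite bnd_simp.
Qed.

Let K r := c_ alpha * derive1 psi r * psi r `^ (- alpha) * expR (- h * psi r).

Lemma mu_ode r : solves_on `[a + h, b]
  (fun t y => - psi r * y + K r * f (t - h)) (fun t => mu t h r).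
Proof.
have ab : a <= b by rewrite -subr_ge0 ltW// (lt_trans h0).
pose P x := \int[leb]_(tau in `[a, x]) (expR (psi r * tau) * f tau).
have dP := derivative_on_primitive ab (continuous_expRM_within (k := psi r)).
have dPh : derivative_on `[a + h, b] (fun t => P (t - h))
    (fun t => expR (psi r * (t - h)) * f (t - h) * (cst 1 t + cst 0 t)).
  apply: (@derivative_on_comp _ _ _ P _ (fun t => t + cst (- h) t)) dP _.
    by move=> x; exact: shift_itv.
  by apply: derivative_onD; [exact: derivative_on_id|exact: derivative_on_cst].
have := derivative_onZ (c := c_ alpha * derive1 psi r * psi r `^ (- alpha))
  (derivative_onM (@derivative_on_expM _ `[a + h, b] (- psi r)) dPh).
apply: eq_derivative_on => t tab; first by rewrite muE.
have E : expR (- h * psi r) = expR (- psi r * t) * expR (psi r * (t - h)).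
  by rewrite -expRD; congr expR; ring.
by rewrite /cst /= muE// /K E -/(P _); ring.
Qed.

Lemma mu_initial r : mu (a + h) h r = 0.
Proof. by rewrite /mu_ addrK set_itv1 Rintegral_set1 mulr0. Qed.

Lemma mu_ode_unique r y : solves_on `[a + h, b]
    (fun t y => - psi r * y + K r * f (t - h)) y -> y (a + h) = 0 ->
  {in `[a + h, b], forall t, y t = mu t h r}.
Proof.
move=> dy ya t tab.
have dN := derivative_onZ (c := -1) (@mu_ode r).
have := derivative_onD dy dN.
set z := (fun x => y x + -1 * mu x h r) => dz.
have {}dz : derivative_on `[a + h, b] z (fun t => - psi r * z t).
  by apply: eq_derivative_on dz => // x _; rewrite /z; ring.
have za : z (a + h) = 0 by rewrite /z ya mu_initial; ring.
have := linear_ode_unique dz za tab; rewrite /z mulN1r => /eqP.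
by rewrite subr_eq0 => /eqP.
Qed.

(** Bootstrapping along the differential equation: its right side combines mu, of the class already
    reached, with a shift of [f], so each round gains one derivative. *)
Lemma Cn_mu_time l r : Cn l `[a, b] f -> Cn l.+1 `[a + h, b] (fun t => mu t h r).
Proof.
have Cshift n : Cn n `[a, b] f -> Cn n `[a + h, b] (fun t => f (t - h)).
  elim: n f => [|n IHn] g /=.
    move=> /subspace_continuousP cg; apply/subspace_continuousP => x xab.
    apply: cvg_comp (cg _ (shift_itv xab)).
    apply: (@cvg_within_within _ _ _ (fun x => x - h)); first exact: shift_itv.
    by apply: cvg_within_filter; apply: cvgB; [exact: cvg_id|exact: cvg_cst].
  move=> [g' dg /IHn Cg']; exists (fun t => g' (t - h)) => //.
  have := derivative_on_comp shift_itv dg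
    (derivative_onD (@derivative_on_id _ `[a + h, b]) (derivative_on_cst (- h))).
  by apply: eq_derivative_on => // x _ /=; rewrite addr0 mulr1.
elim: l => [|l IHl] Cf; (eexists; first exact: mu_ode).
  apply: (@Cn_D _ 0); apply: (@Cn_Z _ 0); last exact: Cshift.
  exact: derivative_on_continuous (@mu_ode r).
apply: Cn_D; apply: Cn_Z; last exact: Cshift.
by apply: IHl; exact: CnS.
Qed.

End memory_in_time.

(** * Regularity of mu in the parameter r *)

Section memory_in_parameter.
Context {R : realType}.
Notation leb := (@lebesgue_measure R).

Lemma continuous_bounded_itv (a b : R) (f : R -> R) : a <= b ->
  {within `[a, b], continuous f} ->
  exists2 M : R, 0 < M & forall x, x \in `[a, b] -> `|f x| <= M.
Proof.
move=> ab cf.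
have [c _ cM] := EVT_max ab (within_continuous_norm cf).
exists (`|f c| + 1) => [|x /cM xc]; first by rewrite ltr_wpDl.
by rewrite (le_trans xc)// lerDl.
Qed.

(** The derivative of order [m] in [s] of the integral of exp(w(tau) s) g(tau). With w(tau) = -(t -
    tau), order 0 at s = psi(r) is the integral inside mu. *)
Definition exp_moment (a b : R) (w g : R -> R) (m : nat) (s : R) : R :=
  \int[leb]_(tau in `[a, b]) (w tau ^+ m * (expR (w tau * s) * g tau)).

Lemma derivative_on_exp_moment (a b : R) (w g : R -> R) m : a <= b ->
  {within `[a, b], continuous w} -> {within `[a, b], continuous g} ->
  derivative_on setT (exp_moment a b w g m) (exp_moment a b w g m.+1).
Proof.
move=> ab cw cg; apply/derivative_on_open; first exact: openT.
move=> s _.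
pose F (x tau : R) := w tau ^+ m * (expR (w tau * x) * g tau).
have dF (x tau : R) :
    is_derive x (1 : R) (F ^~ tau) (w tau ^+ m.+1 * (expR (w tau * x) * g tau)).
  have H := is_derive_expM (w tau) x.
  rewrite /F; apply: trigger_derive.
  by rewrite /GRing.scale/= exprS; ring.
have cF x : {within `[a, b], continuous (F x)}.
  apply: (@Cn_M _ 0 `[a, b] (fun tau => w tau ^+ m)).
    by elim: (m) => [|n IHn]; [exact: (@Cn_cst _ 0 _ 1)|];
      apply: eq_Cn (@Cn_M _ 0 _ _ _ cw IHn) => y _; rewrite exprS.
  apply: (@Cn_M _ 0 `[a, b] (fun tau => expR (w tau * x))) => //.
  move=> y; apply: continuous_comp; last exact: continuous_expR.
  exact: (@Cn_M _ 0 _ _ _ cw (@Cn_cst _ 0 _ x)).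
have [W W0 wW] := continuous_bounded_itv ab cw.
have [G G0 gG] := continuous_bounded_itv ab cg.
(* Dominates the differentiated integrand for all [x] within distance 1 of [s], since there |x| is
   at most |s| + 1. *)
pose B : R := W ^+ m.+1 * (expR (W * (`|s| + 1)) * G).
have dFE x tau : partial1of2 F x tau = w tau ^+ m.+1 * (expR (w tau * x) * g tau).
  by rewrite partial1of2E; have := dF x tau => ?; rewrite derive_val.
have Is : `](s - 1), (s + 1)[%classic s by rewrite /= in_itv/= ltrBlDr !ltrDl ltr01.
have mab : measurable (`[a, b]%classic : set (measurableTypeR R)) by exact: measurable_itv.
have iF x : `](s - 1), (s + 1)[%classic x -> leb.-integrable `[a, b] (EFin \o F x).
  by move=> _; exact: continuous_integrable_itv.
have dF1 x y : `](s - 1), (s + 1)[%classic x -> `[a, b]%classic y -> derivable (F ^~ y) x 1.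
  by move=> _ _; have := dF x y => ?.
have B0 (y : R) : 0 <= cst B y.
  by rewrite /cst /B mulr_ge0 ?exprn_ge0 ?mulr_ge0 ?expR_ge0 ?ltW.
have iB : leb.-integrable `[a, b] (EFin \o cst B).
  by apply: continuous_integrable_itv; exact: (@Cn_cst _ 0).
have Bub x y : `](s - 1), (s + 1)[%classic x -> `[a, b]%classic y ->
    `|partial1of2 F x y| <= cst B y.
  move=> /= xs yab; rewrite dFE !normrM normrX.
  rewrite /cst /B ler_pM ?mulr_ge0 ?exprn_ge0//.
    by rewrite lerXn2r ?nnegrE ?wW// ltW.
  rewrite ler_pM ?gG// ger0_norm ?expR_ge0// ler_expR.
  rewrite (le_trans (ler_norm _))// normrM ler_pM ?wW//.
  move: xs; rewrite in_itv/= => /andP[xs1 xs2].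
  rewrite ler_norml; apply/andP; split.
    rewrite opprD; apply: ltW; apply: le_lt_trans xs1.
    by rewrite lerD2r lerNl -normrN ler_norm.
  by rewrite ltW// (lt_le_trans xs2)// lerD2r ler_norm.
have := derivable_under_integral mab Is iF dF1 B0 iB Bub.
have := differentiation_under_integral mab Is iF dF1 B0 iB Bub.
rewrite derive1E => E1 E2; apply: DeriveDef; first exact: E2.
by rewrite [LHS]E1; apply: eq_Rintegral => tau _; exact: dFE.
Qed.

Lemma derivative_on_powR (p c : R) :
  derivative_on `]0, +oo[ (fun s => c * s `^ p) (fun s => c * p * s `^ (p - 1)).
Proof.
apply/derivative_on_open; first exact: interval_open.
move=> s /= s0; apply: DeriveDef.
  by apply: derivableM => //; apply: derivable_powR; rewrite inE.
rewrite deriveZ/=; last by apply: derivable_powR; rewrite inE.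
by rewrite -derive1E powR_derive1// /GRing.scale/= mulrA.
Qed.

Lemma Cn_powR_comp n (p : R) D (psi : R -> R) : (forall r, D r -> 0 < psi r) ->
  Cn n D psi -> Cn n D (fun r => psi r `^ p).
Proof.
move=> psi0 Cpsi.
(* The derivative of order [m] of s^p, with a falling factorial of [p] as coefficient. *)
pose F (m : nat) (s : R) := \prod_(i < m) (p - i%:R) * s `^ (p - m%:R).
have dF m : derivative_on `]0, +oo[ (F m) (F m.+1).
  have := derivative_on_powR (p := p - m%:R) (c := \prod_(i < m) (p - i%:R)).
  apply: eq_derivative_on => // s _.
  by rewrite /F big_ord_recr /= -[in RHS]natr1 opprD addrA.
have psiD r : D r -> `]0, +oo[%classic (psi r) by move=> /psi0; rewrite /= in_itv/= andbT.
apply: eq_Cn (Cn_comp psiD dF Cpsi 0) => r _.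
by rewrite /F big_ord0 mul1r subr0.
Qed.

Lemma Cn_mu_parameter (a b : R) (f : R -> R) alpha (Omega : set R) (psi : R -> R) h t k :
  {within `[a, b], continuous f} -> 0 < h -> t \in `[a + h, b] ->
  open Omega -> (forall r, Omega r -> 0 < psi r) ->
  Cn k.+1 Omega psi -> Cn k Omega (mu_ a f alpha psi t h).
Proof.
move=> cf h0 tab oO psi0 Cpsi; have Cpsi0 := CnS Cpsi.
have := shift_itv h0 tab; rewrite in_itv/= => /andP[ath thb].
apply: Cn_M.
  by apply: Cn_M; [apply: Cn_Z; exact: Cn_derive1|exact: Cn_powR_comp].
pose w (tau : R) := - (t - tau).
have cfS : {within `[a, t - h], continuous f}.
  by apply: continuous_subspaceW cf; apply: subset_itvl; rewrite bnd_simp.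
have cw : {within `[a, t - h], continuous w}.
  apply: continuous_subspaceT => x; apply: cvgN; apply: cvgB; last exact: cvg_id.
  exact: cvg_cst.
have dF m := derivative_on_exp_moment (m := m) ath cw cfS.
apply: eq_Cn (Cn_comp _ dF Cpsi0 0) => // r _.
by apply: eq_Rintegral => tau _; rewrite expr0 mul1r.
Qed.

End memory_in_parameter.

(** * Substitution along an admissible transformation *)

Section substitution.
Context {R : realType}.
Notation leb := (@lebesgue_measure R).
Implicit Types (Omega : set R) (psi g : R -> R).

(** What the change of variable uses of an admissible transformation. It also covers s -> c s on the
    positive half-line and exp on the line, so one substitution lemma serves the Gamma integrals as
    well. *)
Definition increasing_C1_onto Omega psi :=
  [/\ open_interval Omega, (forall r, Omega r -> 0 < psi r),
      {in Omega &, {homo psi : r s / r < s}}, Cn 1 Omega psi &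
      forall y, 0 < y -> exists2 r, Omega r & psi r = y].

Lemma interval_segment Omega r s : is_interval Omega -> Omega r -> Omega s ->
  `[r, s] `<=` Omega.
Proof.
by move=> iO Or Os x /=; rewrite in_itv/= => rxs; apply: iO rxs.
Qed.

(** The filter at the lower end is proper: points of Omega come arbitrarily close to the infimum if
    it is finite, and go below every bound if it is -oo. The value +oo is excluded by the point
    [r0]. *)
Lemma toward_inf_ex Omega (P : set R) : Omega !=set0 ->
  toward Omega (inf_end Omega) P -> exists2 r, Omega r & P r.
Proof.
move=> [r0 Or0] [U Uinf UP].
suff [r [Or Ur]] : exists r, Omega r /\ U r%:E by exists r => //; exact: UP.
have inf_le : (inf_end Omega <= r0%:E)%E by apply: ereal_inf_lbound; exists r0.
have inf_lt (y : \bar R) : (inf_end Omega < y)%E -> exists2 r, Omega r & (r%:E < y)%E.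
  by move=> /ereal_inf_lt[_ [r Or <-] ry]; exists r.
have lb r : Omega r -> (inf_end Omega <= r%:E)%E.
  by move=> Or; apply: ereal_inf_lbound; exists r.
move: Uinf inf_le inf_lt lb; case: (inf_end Omega) => [x||] //= Uinf _ inf_lt lb.
  have [e /= e0 eU] : nbhs x (fun x => U x%:E) by [].
  have [|r Or] := inf_lt (x + e)%:E; first by rewrite lte_fin ltrDl.
  rewrite lte_fin => rxe; exists r; split => //; apply: eU.
  have := lb r Or; rewrite lee_fin => xr.
  by rewrite /= ler0_norm ?subr_le0// opprB ltrBlDl.
have [M [Mr MU]] := Uinf.
have [|r Or rM] := inf_lt M%:E; first exact: ltNyr.
by exists r; split => //; exact: MU.
Qed.

Lemma toward_sup_ex Omega (P : set R) : Omega !=set0 ->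
  toward Omega (sup_end Omega) P -> exists2 r, Omega r & P r.
Proof.
move=> [r0 Or0] [U Usup UP].
suff [r [Or Ur]] : exists r, Omega r /\ U r%:E by exists r => //; exact: UP.
have sup_ge : (r0%:E <= sup_end Omega)%E by apply: ereal_sup_ubound; exists r0.
have sup_gt (y : \bar R) : (y < sup_end Omega)%E -> exists2 r, Omega r & (y < r%:E)%E.
  by move=> /ereal_sup_gt[_ [r Or <-] ry]; exists r.
have ub r : Omega r -> (r%:E <= sup_end Omega)%E.
  by move=> Or; apply: ereal_sup_ubound; exists r.
move: Usup sup_ge sup_gt ub; case: (sup_end Omega) => [x||] //= Usup _ sup_gt ub.
  have [e /= e0 eU] : nbhs x (fun x => U x%:E) by [].
  have [|r Or] := sup_gt (x - e)%:E; first by rewrite lte_fin ltrBlDr ltrDl.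
  rewrite lte_fin => rxe; exists r; split => //; apply: eU.
  have := ub r Or; rewrite lee_fin => xr.
  by rewrite /= ger0_norm ?subr_ge0// ltrBlDr -ltrBlDl.
have [M [Mr MU]] := Usup.
have [|r Or rM] := sup_gt M%:E; first exact: ltry.
by exists r; split => //; exact: MU.
Qed.

(** The limits at the two ends provide values of psi below and above a given [y]; monotonicity
    orders their arguments, and the intermediate value theorem applies on the segment between
    them. *)
Lemma admissible_onto Omega psi : open_interval Omega -> admissible Omega psi ->
  increasing_C1_onto Omega psi.
Proof.
move=> [ne oO iO] [psi0 psi_incr Cpsi psi_inf psi_sup].
have psi0' r : Omega r -> 0 < psi r by move=> Or; exact: psi0 (mem_set Or).
split => // y y0.
have [r Or ry] : exists2 r, Omega r & psi r < y.
  by apply: toward_inf_ex => //; exact: cvgr_lt psi_inf _ y0.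
have [s Os ys] : exists2 s, Omega s & y < psi s.
  by apply: toward_sup_ex => //; move/cvgryPgt: psi_sup; exact.
have rs : r <= s.
  rewrite leNgt; apply/negP => sr.
  have := psi_incr _ _ (mem_set Os) (mem_set Or) sr.
  by rewrite ltNge => /negP; apply; exact/ltW/(lt_trans ry).
have cpsi : {within `[r, s], continuous psi}.
  by apply: continuous_subspaceW (Cn_continuous Cpsi); exact: interval_segment.
have [|c crs <-] := IVT (v := y) rs cpsi.
  by rewrite ge_min (ltW ry)/= le_max (ltW ys) orbT.
by exists c => //; exact: interval_segment crs.
Qed.

Lemma increasing_C1_onto_derive1_ge0 Omega psi r : increasing_C1_onto Omega psi ->
  Omega r -> 0 <= derive1 psi r.
Proof.
move=> [[ne oO iO] psi0 psi_incr [g dg _] _] Or.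
apply: (incr_derive1_ge0 (D := Omega)) => //; rewrite (interior_id Omega).1//.
move=> x; rewrite inE => Ox.
by have := (derivative_on_open psi g oO).1 dg _ Ox => ?.
Qed.

(** Omega may be unbounded and psi' may blow up at its ends, so the formula is used on segments and
    passed to the limit by monotone convergence. Nonnegativity lets both sides be +oo, so the lemma
    applies before any integrability is known. *)
Lemma ge0_integral_substitution Omega psi g : increasing_C1_onto Omega psi ->
  (forall s, 0 < s -> {for s, continuous g}) -> (forall s, 0 < s -> 0 <= g s) ->
  (\int[leb]_(r in Omega) (g (psi r) * derive1 psi r)%:E =
   \int[leb]_(s in `]0%R, +oo[) (g s)%:E)%E.
Proof.
move=> psiP cg g0; have dpsi0 := increasing_C1_onto_derive1_ge0 psiP.
move: psiP => [[ne oO iO] psi0 psi_incr Cpsi psi_onto].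
have cpsi' : {in Omega, continuous (derive1 psi)}.
  by rewrite -continuous_open_subspace//; exact: (@Cn_derive1 _ 0).
have dpsi r : Omega r -> derivable psi r 1.
  case: Cpsi => [p dp _] Or.
  by have := (derivative_on_open psi p oO).1 dp _ Or => ?.
have cpsi r : Omega r -> {for r, continuous psi}.
  by move=> /dpsi/derivable1_diffP/differentiable_continuous.
(* The endpoints are chosen through their images, 1/(n+1) here and n+1 below, so that psi maps [E n]
   onto [F n] and the exhaustion of Omega follows from that of the half-line. *)
have /boolp.choice[u uP] (n : nat) : exists r, Omega r /\ psi r = n.+1%:R^-1.
  by have [|r Or <-] := psi_onto n.+1%:R^-1; [rewrite invr_gt0|exists r].
have /boolp.choice[v vP] (n : nat) : exists r, Omega r /\ psi r = n.+1%:R.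
  by have [|r Or <-] := psi_onto n.+1%:R; [|exists r].
have psi_le r s : Omega r -> Omega s -> (psi r <= psi s) = (r <= s).
  move=> Or Os; apply/idP/idP; last first.
    rewrite le_eqVlt => /predU1P[->//|rs].
    by apply: ltW; apply: psi_incr; rewrite ?inE.
  apply: contra_le => sr; apply: psi_incr; rewrite ?inE//.
have inv1 (n : nat) : n.+1%:R^-1 <= n.+1%:R :> R.
  by rewrite (@le_trans _ _ 1) ?invf_le1 ?ler1n ?ltr0n.
have uv n : u n <= v n.
  by have [? pu] := uP n; have [? pv] := vP n; rewrite -psi_le// pu pv.
pose E n := `[u n, v n]%classic; pose F (n : nat) := `[n.+1%:R^-1 : R, n.+1%:R]%classic.
have EO n : E n `<=` Omega.
  by apply: interval_segment => //; [exact: (uP n).1|exact: (vP n).1].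
have EP n r : Omega r -> E n r <-> n.+1%:R^-1 <= psi r <= n.+1%:R.
  move=> Or; rewrite /E /= in_itv/=.
  have [? pu] := uP n; have [? pv] := vP n.
  by rewrite -pu -pv !psi_le.
have FE n m : (n <= m)%N -> F n `<=` F m.
  move=> nm x; rewrite /F /= !in_itv/= => /andP[nx xn]; apply/andP; split.
    by apply: le_trans nx; rewrite lef_pV2 ?posrE// ler_nat.
  by apply: le_trans xn _; rewrite ler_nat.
have unF : \bigcup_n F n = `]0%R, +oo[%classic.
  apply/seteqP; split => [x [n _]|x]; rewrite /= !in_itv/= andbT.
    by rewrite /F /= in_itv/= => /andP[nx _]; apply: lt_le_trans nx; rewrite invr_gt0.
  (* With this index, n+1 exceeds both x and 1/x. *)
  move=> x0; exists (maxn (Num.trunc x) (Num.trunc x^-1)) => //=.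
  rewrite /F /= in_itv/= invf_ple ?posrE//.
  have H (y : R) : 0 <= y -> (Num.trunc y <= maxn (Num.trunc x) (Num.trunc x^-1))%N ->
     y <= (maxn (Num.trunc x) (Num.trunc x^-1)).+1%:R.
    move=> y0 ym; apply: ltW; apply: (@lt_le_trans _ _ (Num.trunc y).+1%:R).
      by exact: truncnS_gt.
    by rewrite ler_nat.
  by rewrite !H ?leq_maxl ?leq_maxr ?invr_ge0 ?ltW.
have unE : \bigcup_n E n = Omega.
  apply/seteqP; split => [x [n _ /EO]//|r Or].
  have : (\bigcup_n F n) (psi r) by rewrite unF /= in_itv/= psi0.
  by move=> [n _]; rewrite /F/= in_itv/= => Fn; exists n => //; apply/EP.
have mG : measurable_fun Omega (EFin \o (fun r => g (psi r) * derive1 psi r)).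
  apply/measurable_EFinP; apply: open_continuous_measurable_fun => // x xO.
  have Ox := set_mem xO.
  apply: (@continuousM _ _ (g \o psi)); last exact: cpsi'.
  by apply: continuous_comp; [exact: cpsi|apply: cg; exact: psi0].
have mg : measurable_fun (`]0%R, +oo[%classic : set R) (EFin \o g).
  apply/measurable_EFinP; apply: open_continuous_measurable_fun => //.
  by move=> x; rewrite inE/= in_itv/= andbT => x0; exact: cg.
have EF n : (\int[leb]_(r in E n) (g (psi r) * derive1 psi r)%:E =
             \int[leb]_(s in F n) (g s)%:E)%E.
  have [Ou pu] := uP n; have [Ov pv] := vP n.
  have c' x : Omega x -> {for x, continuous (derive1 psi)}.
    by move=> Ox; apply: cpsi'; rewrite inE.
  have H1 : {in `[u n, v n] &, {homo psi : x y / x < y}}.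
    by move=> x y xE yE; apply: psi_incr; rewrite inE; exact: (EO n).
  have H2 : {in `]u n, v n[, continuous (derive1 psi)}.
    by move=> x /subset_itv_oo_cc xE; exact/c'/(EO n).
  have H3 : cvg (derive1 psi x @[x --> (u n)^'+]).
    by apply/cvg_ex; exists (derive1 psi (u n)); apply: cvg_at_right_filter; exact: c'.
  have H4 : cvg (derive1 psi x @[x --> (v n)^'-]).
    by apply/cvg_ex; exists (derive1 psi (v n)); apply: cvg_at_left_filter; exact: c'.
  have H5 : derivable_oo_LRcontinuous psi (u n) (v n).
    split.
    - by move=> x /subset_itv_oo_cc xE; exact/dpsi/(EO n).
    - by apply: cvg_at_right_filter; exact: cpsi.
    - by apply: cvg_at_left_filter; exact: cpsi.
  have H6 : {within `[psi (u n), psi (v n)], continuous g}.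
    apply: continuous_in_subspaceT => x; rewrite inE/= in_itv/= => /andP[ux _].
    by apply: cg; apply: lt_le_trans ux; exact: psi0.
  rewrite /F -pu -pv.
  by rewrite (integration_by_substitution_increasing (uv n) H1 H2 H3 H4 H5 H6).
rewrite -unE -unF.
have mE n : measurable (E n : set (measurableTypeR R)) by exact: measurable_itv.
have mF n : measurable (F n : set (measurableTypeR R)) by exact: measurable_itv.
have EE : {homo E : n m / (n <= m)%N >-> (n <= m)%O}.
  move=> n m nm; apply/subsetPset => x En; apply/EP; first exact: EO En.
  have := FE n m nm (psi x); rewrite /F /= !in_itv/=; apply.
  by apply/EP => //; exact: EO En.
have FF : {homo F : n m / (n <= m)%N >-> (n <= m)%O}.
  by move=> n m nm; apply/subsetPset; exact: FE.
have FO n : F n `<=` `]0%R, +oo[ by rewrite -unF; exact: bigcup_sup.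
have cvE : (\int[leb]_(r in E n) (g (psi r) * derive1 psi r)%:E)%E @[n --> \oo] -->
    (\int[leb]_(r in \bigcup_n E n) (g (psi r) * derive1 psi r)%:E)%E.
  apply: (@ge0_nondecreasing_set_cvg_integral _ (measurableTypeR R) R E _ leb EE mE).
    by move=> n; apply: measurable_funS (EO n) mG; exact: open_measurable.
  by move=> n x /EO Ox; rewrite lee_fin mulr_ge0 ?dpsi0// g0// psi0.
have cvF : (\int[leb]_(s in F n) (g s)%:E)%E @[n --> \oo] -->
    (\int[leb]_(s in \bigcup_n F n) (g s)%:E)%E.
  apply: (@ge0_nondecreasing_set_cvg_integral _ (measurableTypeR R) R F _ leb FF mF).
    by move=> n; apply: measurable_funS (FO n) mg; exact: measurable_itv.
  by move=> n x /FO; rewrite /= in_itv/= andbT lee_fin; exact: g0.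
by apply: (cvg_unique _ cvE); rewrite //= (eq_cvg _ _ EF).
Qed.

End substitution.

(** * Fubini on a rectangle *)

Section fubini_on.
Local Open Scope ereal_scope.
Context d1 d2 (T1 : measurableType d1) (T2 : measurableType d2) (R : realType).
Variables (m1 : {sigma_finite_measure set T1 -> \bar R}).
Variables (m2 : {sigma_finite_measure set T2 -> \bar R}).
Variables (A : set T1) (B : set T2) (f : T1 * T2 -> R).
Hypotheses (mA : measurable A) (mB : measurable B).
Hypothesis mf : measurable_fun (A `*` B) f.

(** Extension by zero, to which Tonelli and Fubini on the full product space apply. *)
Let g : T1 * T2 -> \bar R := (EFin \o f) \_ (A `*` B).

Let mg : measurable_fun setT g.
Proof.
apply/(measurable_restrictT _ _).1; first exact: measurableX.
exact/measurable_EFinP.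
Qed.

Let integral2_restrict (h : R -> R) : h 0%R = 0%R ->
  (fun x => \int[m2]_y (EFin \o h \o fine) (g (x, y))) =
  (fun x => \int[m2]_(y in B) (h (f (x, y)))%:E) \_ A.
Proof.
move=> h0; apply/funext => x; rewrite [in RHS]patchE; case: ifPn => xA.
  rewrite [in RHS]integral_mkcond; apply: eq_integral => y _.
  rewrite /g /= !patchE; case: ifPn => [|yB].
    by rewrite inE => -[_ yB] /=; rewrite ifT// inE.
  rewrite ifF /=; first by rewrite h0.
  by apply/negbTE; apply: contra yB; rewrite !inE => yB; split => //=; exact: set_mem.
apply: integral0_eq => y _ /=; rewrite /g patchE ifF ?h0//.
by apply/negbTE; apply: contra xA; rewrite !inE => -[].
Qed.

(** [h] is the identity in [integral1_g] and the norm in [ig]; both fix 0, so points off the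
    rectangle contribute nothing. *)
Let integral1_restrict (h : R -> R) : h 0%R = 0%R ->
  (fun y => \int[m1]_x (EFin \o h \o fine) (g (x, y))) =
  (fun y => \int[m1]_(x in A) (h (f (x, y)))%:E) \_ B.
Proof.
move=> h0; apply/funext => y; rewrite [in RHS]patchE; case: ifPn => yB.
  rewrite [in RHS]integral_mkcond; apply: eq_integral => x _.
  rewrite /g /= !patchE; case: ifPn => [|xA].
    by rewrite inE => -[xA _] /=; rewrite ifT// inE.
  rewrite ifF /=; first by rewrite h0.
  by apply/negbTE; apply: contra xA; rewrite !inE => xA; split => //=; exact: set_mem.
apply: integral0_eq => x _ /=; rewrite /g patchE ifF ?h0//.
by apply/negbTE; apply: contra yB; rewrite !inE => -[].
Qed.

Let gE z : g z = (fine (g z))%:E.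
Proof. by rewrite /g patchE; case: ifP. Qed.

Let integral2_g : (fun x => \int[m2]_y g (x, y)) =
  (fun x => \int[m2]_(y in B) (f (x, y))%:E) \_ A.
Proof.
rewrite -(@integral2_restrict id erefl); apply/funext => x.
by apply: eq_integral => y _; rewrite gE.
Qed.

Let integral1_g : (fun y => \int[m1]_x g (x, y)) =
  (fun y => \int[m1]_(x in A) (f (x, y))%:E) \_ B.
Proof.
rewrite -(@integral1_restrict id erefl); apply/funext => y.
by apply: eq_integral => x _; rewrite gE.
Qed.

Lemma fubini_tonelli_on : (forall x y, A x -> B y -> 0 <= f (x, y))%R ->
  \int[m1]_(x in A) \int[m2]_(y in B) (f (x, y))%:E =
  \int[m2]_(y in B) \int[m1]_(x in A) (f (x, y))%:E.
Proof.
move=> f0; have g0 z : 0 <= g z.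
  rewrite /g patchE; case: ifPn => //; case: z => x y; rewrite inE => -[/= Ax By].
  by rewrite lee_fin f0.
rewrite integral_mkcond [in RHS]integral_mkcond -integral1_g -integral2_g.
exact: (fubini_tonelli (m1 := m1) (m2 := m2) g mg g0).
Qed.

Hypothesis f_lty : \int[m2]_(y in B) \int[m1]_(x in A) (`|f (x, y)|%R)%:E < +oo.

Let ig : (m1 \x m2).-integrable setT g.
Proof.
apply/(integrable21ltyP _ _ mg); apply: le_lt_trans f_lty.
rewrite [leRHS]integral_mkcond -(@integral1_restrict Num.norm (normr0 _)).
rewrite le_eqVlt; apply/orP; left; apply/eqP.
by apply: eq_integral => y _; apply: eq_integral => x _; rewrite gE.
Qed.

Lemma integrable_fubini_on :
  m1.-integrable A (fun x => \int[m2]_(y in B) (f (x, y))%:E).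
Proof.
apply/integrable_mkcond => //; rewrite -integral2_g.
exact: integrable_fubini_F ig.
Qed.

Lemma fubini_on : \int[m1]_(x in A) \int[m2]_(y in B) (f (x, y))%:E =
  \int[m2]_(y in B) \int[m1]_(x in A) (f (x, y))%:E.
Proof.
rewrite integral_mkcond [in RHS]integral_mkcond -integral1_g -integral2_g.
exact: Fubini ig.
Qed.

End fubini_on.

(** * Products of Gamma integrals *)

Section gamma.
Context {R : realType}.
Notation leb := (@lebesgue_measure R).
Implicit Types (p x c : R).

(** Extended-real valued, since finiteness is only read off the reflection formula. The argument is
    the exponent: [egamma (x - 1)] stands for Gamma at x. *)
Definition egamma p : \bar R :=
  (\int[leb]_(s in `]0%R, +oo[) (s `^ p * expR (- s))%:E)%E.

Lemma egamma_ge0 p : (0 <= egamma p)%E.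
Proof.
by apply: integral_ge0 => s _; rewrite lee_fin mulr_ge0 ?powR_ge0 ?expR_ge0.
Qed.

Lemma GammaE x : Gamma x = fine (egamma (x - 1)).
Proof. by []. Qed.

Lemma continuous_powR p (s : R) : 0 < s -> {for s, continuous (fun s : R => s `^ p)}.
Proof.
move=> s0; apply/differentiable_continuous/derivable1_diffP/derivable_powR.
have s0' : s \in `]0, +oo[ by rewrite in_itv/= s0.
by rewrite inE.
Qed.

Lemma continuous_powR_exp p c (s : R) : 0 < s ->
  {for s, continuous (fun s : R => s `^ p * expR (- (c * s)))}.
Proof.
move=> s0; apply: (@continuousM _ _ (fun s : R => s `^ p)); first exact: continuous_powR.
apply: continuous_comp; last exact: continuous_expR.
by apply: continuousN; apply: continuousM; [exact: cst_continuous|exact: cvg_id].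
Qed.

Lemma measurable_powR_exp p c (D : set R) :
  measurable_fun D (fun s => s `^ p * expR (- (c * s))).
Proof.
apply: measurable_funM; first exact: measurable_funTS (measurable_powR p).
apply: measurable_funTS; apply: measurableT_comp => //.
by apply: measurableT_comp => //; exact: measurable_funM.
Qed.

Lemma scale_C1_onto c : 0 < c -> increasing_C1_onto `]0, +oo[ ( *%R c).
Proof.
move=> c0; split.
- split; [|exact: interval_open|exact: interval_is_interval].
  by exists 1; rewrite /= in_itv/= ltr01.
- by move=> r; rewrite /= in_itv/= andbT => r0; rewrite mulr_gt0.
- by move=> r s _ _ rs; rewrite ltr_pM2l.
- exact: (@Cn_Z _ 1 _ c id (@Cn_id _ 1 _)).
- move=> y y0; exists (c^-1 * y); last by rewrite mulVKf ?gt_eqF.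
  by rewrite /= in_itv/= andbT mulr_gt0 ?invr_gt0.
Qed.

Lemma exp_C1_onto : increasing_C1_onto [set: R] expR.
Proof.
split.
- by split; [exists 0|exact: openT|].
- by move=> r _; exact: expR_gt0.
- by move=> r s _ _ rs; rewrite ltr_expR.
- exists expR; last by apply: continuous_subspaceT; exact: continuous_expR.
  by apply: (derivative_on_open _ _ openT).2 => x _; exact: is_derive_expR.
- by move=> y y0; exists (ln y) => //; rewrite lnK.
Qed.

Lemma derive1_scale c r : derive1 ( *%R c) r = c :> R.
Proof.
have := derivative_onZ (c := c) (@derivative_on_id R setT).
by move=> /(derivative_on_derive1 openT)/(_ (I : [set: R] r)) ->; rewrite /= mulr1.
Qed.

Lemma integral_powR_exp p c : 0 < c ->
  (\int[leb]_(s in `]0%R, +oo[) (s `^ p * expR (- (c * s)))%:E =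
   (c `^ (- p - 1))%:E * egamma p)%E.
Proof.
move=> c0.
have -> : egamma p = ((c `^ (p + 1))%:E *
    \int[leb]_(s in `]0%R, +oo[) (s `^ p * expR (- (c * s)))%:E)%E.
  rewrite /egamma.
  under eq_integral do rewrite -[X in - X]mul1r.
  rewrite -(ge0_integral_substitution (scale_C1_onto c0)); last 2 first.
  - by move=> s s0; exact: continuous_powR_exp.
  - by move=> s _; rewrite mulr_ge0 ?powR_ge0 ?expR_ge0.
  rewrite -ge0_integralZl//=; last 3 first.
  - by apply/measurable_EFinP; exact: measurable_powR_exp.
  - by move=> s _; rewrite lee_fin mulr_ge0 ?powR_ge0 ?expR_ge0.
  - by rewrite lee_fin powR_ge0.
  apply: eq_integral => s; rewrite inE/= in_itv/= andbT => s0.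
  rewrite -EFinM derive1_scale; congr EFin.
  have -> : c `^ (p + 1) = c `^ p * c.
    by rewrite powRD ?powRr1 ?(gt_eqF c0) ?implybT// ltW.
  by rewrite powRM 1?ltW// mul1r; ring.
rewrite muleA -EFinM -powRD ?(gt_eqF c0) ?implybT//.
by rewrite [X in c `^ X](_ : _ = 0) ?powRr0 ?mul1e//; ring.
Qed.

Lemma integral_psi_powR_exp (Omega : set R) (psi : R -> R) p c :
  increasing_C1_onto Omega psi -> 0 < c ->
  (\int[leb]_(r in Omega) (psi r `^ p * expR (- (c * psi r)) * derive1 psi r)%:E =
   (c `^ (- p - 1))%:E * egamma p)%E.
Proof.
move=> psiP c0; rewrite -integral_powR_exp//.
apply: (ge0_integral_substitution (g := fun s => s `^ p * expR (- (c * s))) psiP) => s s0.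
  exact: continuous_powR_exp.
by rewrite mulr_ge0 ?powR_ge0 ?expR_ge0.
Qed.

(** Up to the factor [c], this is the total mass of the exponential distribution. *)
Lemma integral_expRN c : 0 < c ->
  (\int[leb]_(s in `[0%R, +oo[) (expR (- (c * s)))%:E = (c^-1)%:E)%E.
Proof.
move=> c0; have := integral_exponential_pdf c0.
have <- : (\int[leb]_(s in `[0%R, +oo[) (c%:E * (expR (- (c * s)))%:E) =
          \int[leb]_x (exponential_pdf c x)%:E)%E.
  rewrite integral_mkcond; apply: eq_integral => s _ /=.
  by rewrite /exponential_pdf !patchE; case: ifP => // _; rewrite -EFinM mulNr.
rewrite ge0_integralZl//=; last 2 first.
- apply/measurable_EFinP; apply: measurable_funTS; apply: measurableT_comp => //.
  by apply: measurableT_comp => //; exact: measurable_funM.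
- by rewrite lee_fin ltW.
move=> /(congr1 (fun z => (c^-1)%:E * z)%E).
by rewrite muleA -EFinM mulVf ?gt_eqF// mul1e mule1.
Qed.

Lemma integral_expRN_open c : 0 < c ->
  (\int[leb]_(s in `]0%R, +oo[) (expR (- (c * s)))%:E = (c^-1)%:E)%E.
Proof.
move=> c0; rewrite integral_itv_obnd_cbnd ?integral_expRN//.
apply/measurable_EFinP; apply: measurable_funTS; apply: measurableT_comp => //.
by apply: measurableT_comp => //; exact: measurable_funM.
Qed.

(** Scaling turns s^(-alpha) Gamma(alpha) into the integral of u^(alpha - 1) e^(-s u) over u. The
    product is then the double integral of u^(alpha - 1) e^(-(1 + u) s), and integrating first in s
    leaves the factor 1 / (1 + u). *)
Lemma egammaM (alpha : R) : 0 < alpha < 1 ->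
  (egamma (alpha - 1) * egamma (- alpha) =
   \int[leb]_(u in `]0%R, +oo[) (u `^ (alpha - 1) / (1 + u))%:E)%E.
Proof.
move=> /andP[a0 a1]; pose D : set R := `]0, +oo[%classic.
have mD : measurable (D : set (measurableTypeR R)) by exact: measurable_itv.
pose F (z : R * R) : R := z.2 `^ (alpha - 1) * expR (- ((1 + z.2) * z.1)).
have mF : measurable_fun (D `*` D) F.
  apply: measurable_funTS; apply: measurable_funM.
    by apply: (measurableT_comp (measurable_powR (alpha - 1))); exact: measurable_snd.
  apply: measurableT_comp => //; apply: measurableT_comp => //.
  apply: measurable_funM; last exact: measurable_fst.
  by apply: measurable_funD => //; exact: measurable_snd.
transitivity (\int[leb]_(s in D) \int[leb]_(u in D) (F (s, u))%:E)%E.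
  rewrite muleC -ge0_integralZr//=; last 3 first.
  - apply/measurable_EFinP; have := @measurable_powR_exp (- alpha) 1 D.
    by under eq_fun do rewrite mul1r.
  - by move=> s _; rewrite lee_fin mulr_ge0 ?powR_ge0 ?expR_ge0.
  - exact: egamma_ge0.
  apply: eq_integral => s; rewrite inE/= in_itv/= andbT => s0.
  rewrite mulrC EFinM -muleA.
  have -> : ((s `^ (- alpha))%:E * egamma (alpha - 1) = 
     \int[leb]_(u in D) (u `^ (alpha - 1) * expR (- (s * u)))%:E)%E.
    by rewrite integral_powR_exp//; congr (_%:E * _)%E; congr (_ `^ _); ring.
  rewrite -ge0_integralZl//=; last 2 first.
  - by apply/measurable_EFinP; exact: measurable_powR_exp.
  - by move=> u _; rewrite lee_fin mulr_ge0 ?powR_ge0 ?expR_ge0.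
  apply: eq_integral => u _; rewrite -EFinM /F/= mulrCA -expRD.
  by congr ((_ * expR _)%:E); ring.
rewrite (fubini_tonelli_on leb leb mD mD mF); last first.
  by move=> x y _ _; rewrite mulr_ge0 ?powR_ge0 ?expR_ge0.
apply: eq_integral => u; rewrite inE /D /= in_itv/= andbT => u0.
rewrite /F/=; under eq_integral do rewrite EFinM.
rewrite ge0_integralZl//=; last 2 first.
- apply/measurable_EFinP; apply: measurable_funTS; apply: measurableT_comp => //.
  by apply: measurableT_comp => //; exact: measurable_funM.
- by rewrite lee_fin powR_ge0.
by rewrite integral_expRN_open ?addr_gt0// -EFinM.
Qed.

Lemma egammaM_exp (alpha : R) : 0 < alpha < 1 ->
  (egamma (alpha - 1) * egamma (- alpha) =
   \int[leb]_(x in `[0%R, +oo[)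
     ((expR (- (alpha * x)) + expR (- ((1 - alpha) * x))) / (1 + expR (- x)))%:E)%E.
Proof.
move=> a01; rewrite egammaM//; move: a01 => /andP[a0 a1].
rewrite -(ge0_integral_substitution exp_C1_onto); last 2 first.
- move=> s s0; apply: continuousM; first exact: continuous_powR.
  apply: continuousV; first by rewrite gt_eqF// addr_gt0.
  by apply: continuousD; [exact: cst_continuous|exact: cvg_id].
- by move=> s s0; rewrite mulr_ge0 ?powR_ge0// invr_ge0 ltW// addr_gt0.
pose K x : R := expR (alpha * x) / (1 + expR x).
have K0 x : 0 <= K x by rewrite divr_ge0 ?expR_ge0// addr_ge0 ?expR_ge0.
have cK : continuous K.
  move=> x; apply: (@continuousM _ _ (fun x => expR (alpha * x)) (fun x => (1 + expR x)^-1)).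
    apply: continuous_comp; last exact: continuous_expR.
    by apply: continuousM; [exact: cst_continuous|exact: cvg_id].
  apply: continuousV; first by rewrite gt_eqF// addr_gt0// expR_gt0.
  by apply: continuousD; [exact: cst_continuous|exact: continuous_expR].
have mK D : measurable_fun D K by apply: measurable_funTS; exact: continuous_measurable_fun.
transitivity (\int[leb]_x (K x)%:E)%E.
  apply: eq_integral => x _; congr EFin.
  have -> : derive1 expR x = expR x by rewrite derive1E; have /funeqP -> := @derive_expR R.
  rewrite -expRM /K mulrAC -expRD.
  by congr (expR _ / _); ring.
(* The line is folded at 0: the negative half contributes [K (- x)]. Multiplying numerator and
   denominator of [K x] by e^(-x) gives both halves the denominator 1 + e^(-x). *)
rewrite -(setUv `]-oo, 0%R]%classic) ge0_integral_setU//=; last 4 first.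
- exact: measurableC.
- by apply/measurable_EFinP; exact: mK.
- by move=> x _; rewrite lee_fin.
- exact/disj_setPCl.
rewrite setCitvl -{1}oppr0 ge0_integration_by_substitutionNy; last 2 first.
- exact: continuous_subspaceT.
- by move=> x _; exact: K0.
rewrite integral_itv_obnd_cbnd; last by apply/measurable_EFinP; exact: mK.
rewrite -ge0_integralD//=; last 4 first.
- by move=> x _; rewrite lee_fin.
- by apply/measurable_EFinP; apply: measurableT_comp (mK setT) _; exact: measurable_funTS.
- by move=> x _; rewrite lee_fin.
- by apply/measurable_EFinP; exact: mK.
apply: eq_integral => x _; rewrite -EFinD; congr EFin; rewrite /K mulrDl mulrN.
congr (_ / _ + _).
rewrite mulrBl mul1r opprB expRD !expRN.
by field; rewrite ?gt_eqF ?addr_gt0 ?expR_gt0.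
Qed.

End gamma.

(** * Dirichlet-type kernels *)

Section dirichlet.
Context {R : realType}.
Notation leb := (@lebesgue_measure R).
Implicit Types (a b c x : R) (n k : nat).

Lemma is_derive_LRcontinuous (F f : R -> R) a b : a < b ->
  (forall x, x \in `[a, b] -> is_derive x (1 : R) F (f x)) ->
  derivable_oo_LRcontinuous F a b /\ {in `]a, b[, derive1 F =1 f}.
Proof.
move=> ab dF; have dF' x : x \in `[a, b] -> derivable F x 1 by move=> /dF ?.
have cF x : x \in `[a, b] -> {for x, continuous F}.
  by move=> /dF'/derivable1_diffP/differentiable_continuous.
split; last first.
  by move=> x /subset_itv_oo_cc /dF H; rewrite derive1E derive_val.
split.
- by move=> x /subset_itv_oo_cc; exact: dF'.
- by apply: cvg_at_right_filter; apply: cF; rewrite in_itv/= lexx ltW.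
- by apply: cvg_at_left_filter; apply: cF; rewrite in_itv/= lexx ltW.
Qed.

Lemma Rintegral_FTC2 (F f : R -> R) a b : a < b ->
  (forall x, x \in `[a, b] -> is_derive x (1 : R) F (f x)) ->
  {within `[a, b], continuous f} ->
  \int[leb]_(x in `[a, b]) f x = F b - F a.
Proof.
move=> ab dF cf; have [FLR F'E] := is_derive_LRcontinuous ab dF.
by rewrite /Rintegral (continuous_FTC2 ab cf FLR F'E).
Qed.

Lemma fine_lebesgue_itv a b : a <= b -> fine (leb `[a, b]%classic) = b - a.
Proof.
move=> ab; have := lebesgue_measure_itv `[a, b]; rewrite /= lte_fin => ->.
by move: ab; rewrite le_eqVlt => /predU1P[->|->]; rewrite ?ltxx ?subrr.
Qed.

Lemma is_derive_sinM c x : is_derive x 1 (fun x => sin (c * x)) (c * cos (c * x)).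
Proof.
by apply: trigger_derive; rewrite /GRing.scale/= mulr1 mulrC.
Qed.

Lemma is_derive_cosM c x : is_derive x 1 (fun x => cos (c * x)) (- (c * sin (c * x))).
Proof.
by apply: trigger_derive; rewrite /GRing.scale/=; ring.
Qed.

Lemma continuous_cosM c : continuous (fun x => cos (c * x)).
Proof.
move=> x; apply: continuous_comp; last exact: continuous_cos.
by apply: continuousM; [exact: cst_continuous|exact: cvg_id].
Qed.

Lemma continuous_sinM c : continuous (fun x => sin (c * x)).
Proof.
move=> x; apply: continuous_comp; last exact: continuous_sin.
by apply: continuousM; [exact: cst_continuous|exact: cvg_id].
Qed.

Lemma Rintegral_cosM c : c != 0 ->
  \int[leb]_(x in `[0, pi]) cos (c * x) = sin (c * pi) / c.
Proof.
move=> c0; have dF x : x \in `[0, pi] ->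
    is_derive x 1 (fun x => c^-1 * sin (c * x)) (cos (c * x)).
  move=> _; have H := is_derive_sinM c x.
  by apply: trigger_derive; rewrite /GRing.scale/= mulKf.
rewrite (Rintegral_FTC2 (pi_gt0 R) dF).
  by rewrite mulr0 sin0 mulr0 subr0 mulrC.
by apply: continuous_subspaceT; exact: continuous_cosM.
Qed.

Lemma sin_piM_gt0 c : 0 < c < 1 -> 0 < sin (pi * c).
Proof.
move=> /andP[c0 c1]; apply: sin_gt0_pi.
by rewrite mulr_gt0 ?pi_gt0//= gtr_pMr ?pi_gt0.
Qed.

Lemma sinDnpi x n : sin (x + n%:R * pi) = (-1) ^+ n * sin x.
Proof.
elim: n => [|n IHn]; first by rewrite mul0r addr0 expr0 mul1r.
by rewrite -natr1 mulrDl mul1r addrA sinDpi IHn exprS mulN1r mulNr.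
Qed.

(* Termwise integration over [0, pi] gives [sin (pi c)] times a partial sum of the
   partial fraction expansion of [pi / sin (pi c)]; for [c = 0] the integral is [pi]. *)
Definition dkernel c n x : R := \sum_(k < n) (cos ((c + k%:R) * x) + cos ((k.+1%:R - c) * x)).

Lemma dkernelS c n x : dkernel c n.+1 x = dkernel c n x +
  (cos ((c + n%:R) * x) + cos ((n.+1%:R - c) * x)).
Proof. by rewrite /dkernel big_ord_recr. Qed.

(** Telescoping. With w = (n + 1/2) x and u = (c - 1/2) x, the n-th summand is cos(w + u) + cos(w -
    u) = 2 cos w cos u, and 2 sin(x/2) cos w = sin((n + 1) x) - sin(n x). *)
Lemma dkernelE c n x :
  sin (2^-1 * x) * dkernel c n x = cos ((c - 2^-1) * x) * sin (n%:R * x).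
Proof.
elim: n => [|n IHn]; first by rewrite /dkernel big_ord0 mul0r sin0 !mulr0.
rewrite dkernelS mulrDr IHn.
set u := (c - 2^-1) * x; set h := 2^-1 * x; pose w := n%:R * x + h.
have -> : (c + n%:R) * x = w + u by rewrite /w /u /h; field.
have -> : (n.+1%:R - c) * x = w - u by rewrite /w /u /h -natr1; field.
have -> : n.+1%:R * x = w + h by rewrite /w /h -natr1; field.
have -> : n%:R * x = w - h by rewrite /w; ring.
clearbody w; clearbody u h.
rewrite cosD cosB sinB sinD; ring.
Qed.

Lemma continuous_dkernel c n : continuous (dkernel c n).
Proof.
elim: n => [|n IHn].
  have -> : dkernel c 0 = cst 0 by apply/funext => x; rewrite /dkernel big_ord0.
  exact: cst_continuous.
rewrite (funext (dkernelS c n)) => x; apply: continuousD; first exact: IHn.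
by apply: continuousD; exact: continuous_cosM.
Qed.

Lemma Rintegral_dkernel c n : \int[leb]_(x in `[0, pi]) dkernel c n x =
  \sum_(k < n) (\int[leb]_(x in `[0, pi]) cos ((c + k%:R) * x) +
                \int[leb]_(x in `[0, pi]) cos ((k.+1%:R - c) * x)).
Proof.
have iC (f : R -> R) : continuous f -> leb.-integrable `[0, pi] (EFin \o f).
  by move=> cf; apply: continuous_integrable_itv; exact: continuous_subspaceT.
elim: n => [|n IHn].
  rewrite big_ord0; under eq_Rintegral do rewrite /dkernel big_ord0.
  by rewrite Rintegral_cst ?mul0r//; exact: measurable_itv.
rewrite big_ord_recr /= -IHn (funext (dkernelS c n)).
rewrite RintegralD//; last 2 first.
- by apply: iC; exact: continuous_dkernel.
- by apply: iC => x; apply: continuousD; exact: continuous_cosM.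
by rewrite RintegralD//; apply: iC; exact: continuous_cosM.
Qed.

(** Among the frequencies only the one for k = 0 in the first cosine is zero; the others are
    positive integers, whose cosines integrate to 0 over [0, pi]. The index [n.+1] ensures that this
    constant term is present. *)
Lemma Rintegral_dkernel0 n : \int[leb]_(x in `[0, pi]) dkernel 0 n.+1 x = pi.
Proof.
have I0 k : \int[leb]_(x in `[0, pi]) cos (k.+1%:R * x) = 0.
  by rewrite Rintegral_cosM// -[_ * pi]add0r sinDnpi sin0 mulr0 mul0r.
rewrite Rintegral_dkernel big_ord_recl big1 => [|k _]; last first.
  by rewrite add0r subr0 !I0 addr0.
rewrite subr0 I0 !addr0.
under eq_Rintegral do rewrite mul0r cos0.
rewrite Rintegral_cst; last exact: measurable_itv.
by rewrite fine_lebesgue_itv ?pi_ge0// mul1r subr0.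
Qed.

Lemma Rintegral_dkernel_sin c n : 0 < c < 1 ->
  \int[leb]_(x in `[0, pi]) dkernel c n x =
  sin (pi * c) * \sum_(k < n) (-1) ^+ k * ((k%:R + c)^-1 + (k%:R + (1 - c))^-1).
Proof.
move=> /andP[c0 c1]; rewrite Rintegral_dkernel mulr_sumr; apply: eq_bigr => k _.
have k1 : 0 < k%:R + c by rewrite ltr_wpDl.
have k2 : 0 < k%:R + (1 - c) by rewrite ltr_wpDl// subr_gt0.
have E : k.+1%:R - c = k%:R + (1 - c) by rewrite -natr1; ring.
rewrite E [c + _]addrC !Rintegral_cosM ?gt_eqF//.
(* Both sines reduce to (-1)^k sin(pi c), the second one by sin(pi - y) = sin y. *)
have -> : (k%:R + c) * pi = pi * c + k%:R * pi by ring.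
have -> : (k%:R + (1 - c)) * pi = (- (pi * c) + pi) + k%:R * pi by ring.
by rewrite !sinDnpi sinDpi sinN opprK; ring.
Qed.

Lemma normr_Rintegral_itv_le (f : R -> R) a b M : a <= b ->
  {within `[a, b], continuous f} -> (forall x, x \in `[a, b] -> `|f x| <= M) ->
  `|\int[leb]_(x in `[a, b]) f x| <= M * (b - a).
Proof.
move=> ab cf fM.
have mab : measurable (`[a, b]%classic : set (measurableTypeR R)) by exact: measurable_itv.
have cnf := within_continuous_norm cf.
apply: le_trans (le_normr_Rintegral mab (continuous_integrable_itv cf)) _.
have -> : M * (b - a) = \int[leb]_(x in `[a, b]) cst M x.
  by rewrite Rintegral_cst// fine_lebesgue_itv.
apply: le_Rintegral => //; first exact: continuous_integrable_itv.
by apply: continuous_integrable_itv; exact: (@Cn_cst _ 0).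
Qed.

(** Integration by parts against the primitive -cos((n + 1) x) / (n + 1): the boundary terms and the
    remaining integral all carry the factor 1 / (n + 1). *)
Lemma Riemann_Lebesgue_C1 (g g' : R -> R) a b : a < b ->
  (forall x, x \in `[a, b] -> is_derive x (1 : R) g (g' x)) ->
  {within `[a, b], continuous g'} ->
  exists C : R, forall n, `|\int[leb]_(x in `[a, b]) (g x * sin (n.+1%:R * x))| <= C / n.+1%:R.
Proof.
move=> ab dg cg'; have [M M0 g'M] := continuous_bounded_itv (ltW ab) cg'.
exists (`|g b| + `|g a| + M * (b - a)) => n.
pose G x : R := - (n.+1%:R^-1 * cos (n.+1%:R * x)).
have dG x : is_derive x (1 : R) G (sin (n.+1%:R * x)).
  have H := is_derive_cosM n.+1%:R x.
  by apply: trigger_derive; rewrite /GRing.scale/= mulrN opprK mulKf.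
have GM x : `|G x| <= n.+1%:R^-1.
  by rewrite normrN normrM ger0_norm// ler_piMr// cos_max.
have [gLR g'E] := is_derive_LRcontinuous ab dg.
have [GLR G'E] := is_derive_LRcontinuous ab (fun x _ => dG x).
have csin : {within `[a, b], continuous (fun x => sin (n.+1%:R * x))}.
  by apply: continuous_subspaceT; exact: continuous_sinM.
rewrite (Rintegration_by_parts ab cg' gLR g'E csin GLR G'E).
have cG : {within `[a, b], continuous G}.
  apply: continuous_subspaceT => x; have := dG x => ?.
  exact/differentiable_continuous/derivable1_diffP.
have cg'G : {within `[a, b], continuous (fun x => g' x * G x)} by exact: (@Cn_M _ 0).
have H : `|\int[leb]_(x in `[a, b]) (g' x * G x)| <= M / n.+1%:R * (b - a).
  apply: normr_Rintegral_itv_le => //; first exact: ltW.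
  by move=> x xab; rewrite normrM ler_pM// g'M.
apply: le_trans (ler_normB _ _) _.
rewrite mulrDl; apply: lerD; last by rewrite mulrAC.
apply: le_trans (ler_normB _ _) _.
by rewrite mulrDl !normrM; apply: lerD; apply: ler_pM.
Qed.

(** By [dkernelE] the difference is governed by cos((c - 1/2) x) - cos(x/2). This is cos(A - B) -
    cos(A + B) = 2 sin A sin B with A = c x / 2 and B = (1 - c) x / 2. *)
Lemma dkernel_diff c n x : 0 < c < 1 -> 0 < x <= pi ->
  dkernel c n x - dkernel 0 n x =
  2 * sin (c / 2 * x) * sin ((1 - c) / 2 * x) / sin (2^-1 * x) * sin (n%:R * x).
Proof.
move=> /andP[c0 c1] /andP[x0 xpi].
have s0 : 0 < sin (2^-1 * x).
  apply: sin_gt0_pi; rewrite mulr_gt0 ?invr_gt0//=.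
  by have := @pi_gt0 R; lra.
have := dkernelE c n x; have := dkernelE 0 n x.
move=> E0 Ec.
apply: (mulfI (lt0r_neq0 s0)).
rewrite mulrBr Ec E0 -mulrBl [RHS]mulrA; congr (_ * _).
rewrite [RHS]mulrC divfK ?gt_eqF//.
have -> : (c - 2^-1) * x = c / 2 * x - (1 - c) / 2 * x by field.
have -> : (0 - 2^-1) * x = - (c / 2 * x + (1 - c) / 2 * x) by field.
by rewrite cosN cosB cosD; ring.
Qed.

(** Sine increases on [0, pi/2], so sin(c x / 2) / sin(x/2) is at most 1, and the other two sines
    are bounded by 1. At x = 0, where the closed form would divide by 0, the two kernels coincide.
    The bound is uniform in [n]. *)
Lemma dkernel_diff_le2 c n x : 0 < c < 1 -> 0 <= x <= pi ->
  `|dkernel c n x - dkernel 0 n x| <= 2.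
Proof.
move=> c01 /andP[]; rewrite le_eqVlt => /predU1P[<- _|x0 xpi].
  rewrite /dkernel; under eq_bigr do rewrite !mulr0.
  by under [in X in _ - X]eq_bigr do rewrite !mulr0; rewrite subrr normr0.
rewrite dkernel_diff ?x0//; move: c01 => /andP[c0 c1].
have pi0 := @pi_gt0 R.
have s0 : 0 < sin (2^-1 * x).
  by apply: sin_gt0_pi; rewrite mulr_gt0 ?invr_gt0//=; lra.
have cx0 : 0 < c / 2 * x by rewrite !mulr_gt0.
have cx1 : c / 2 * x < 2^-1 * x by rewrite ltr_pM2r// gtr_pMl// invr_gt0.
have sA : 0 <= sin (c / 2 * x) <= sin (2^-1 * x).
  apply/andP; split; first by apply/ltW/sin_gt0_pi; rewrite cx0/=; lra.
  by apply: ltW; rewrite ltr_sin// in_itv/=; apply/andP; split; lra.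
move: sA => /andP[sA0 sA1].
rewrite normrM -[leRHS]mulr1 ler_pM ?sin_max//.
rewrite mulrAC normrM -[leRHS]mulr1 ler_pM ?sin_max//.
rewrite ger0_norm; last by rewrite divr_ge0 ?mulr_ge0// ltW.
by rewrite ler_pdivrMr// ler_pM2l.
Qed.

End dirichlet.

(** * Euler's reflection formula *)

Section reflection.
Context {R : realType}.
Notation leb := (@lebesgue_measure R).
Variable c : R.
Hypothesis c01 : 0 < c < 1.

Let c0 : 0 < c. Proof. by have /andP[] := c01. Qed.
Let c1 : 0 < 1 - c. Proof. by rewrite subr_gt0; have /andP[] := c01. Qed.

Let Q k : R := (k%:R + c)^-1 + (k%:R + (1 - c))^-1.

Let Q_le k : Q k.+1 <= 2 / k.+1%:R.
Proof.
have H (d : R) : 0 < d -> (k.+1%:R + d)^-1 <= k.+1%:R^-1.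
  by move=> d0; rewrite lef_pV2 ?posrE ?addr_gt0 ?ltr0n// lerDl ltW.
have -> : 2 / k.+1%:R = k.+1%:R^-1 + k.+1%:R^-1 :> R by ring.
by apply: lerD; exact: H.
Qed.

(* On [0, e] the difference with the kernel for [c = 0] is at most 2; on [e, pi] the
   integrand is a C^1 function times [sin (n.+1 x)], which Riemann-Lebesgue handles. *)
Lemma dkernel_integral_cvg (e : R) : 0 < e < pi -> exists C, forall n,
  `|\int[leb]_(x in `[0, pi]) dkernel c n.+1 x - pi| <= C / n.+1%:R + 2 * e.
Proof.
move=> /andP[e0 epi].
pose S x := sin (2^-1 * x) : R.
have S0 x : x \in `[e, pi] -> 0 < S x.
  rewrite in_itv/= => /andP[ex xpi]; apply: sin_gt0_pi.
  have x0 : 0 < x := lt_le_trans e0 ex.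
  by rewrite mulr_gt0 ?invr_gt0//=; have := @pi_gt0 R; lra.
pose A x := sin (c / 2 * x) : R; pose B x := sin ((1 - c) / 2 * x) : R.
pose A' x := c / 2 * cos (c / 2 * x) : R.
pose B' x := (1 - c) / 2 * cos ((1 - c) / 2 * x) : R.
pose S' x := 2^-1 * cos (2^-1 * x) : R.
pose g x := 2 * A x * B x / S x.
pose g' x := 2 * (A' x * B x + A x * B' x) / S x - 2 * A x * B x * S' x / S x / S x.
have dg x : x \in `[e, pi] -> is_derive x (1 : R) g (g' x).
  move=> /S0 Sx0.
  have dA := is_derive_sinM (c / 2) x; have dB := is_derive_sinM ((1 - c) / 2) x.
  have dS := is_derive_sinM 2^-1 x.
  have dSV := is_deriveV (lt0r_neq0 Sx0) dS.
  rewrite /g; apply: trigger_derive.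
  rewrite /GRing.scale/= /g' /A' /B' /S' -/(A x) -/(B x) -/(S x).
  by field; rewrite gt_eqF.
have cg' : {within `[e, pi], continuous g'}.
  apply: continuous_in_subspaceT => x; rewrite inE/= => /S0 Sx0.
  have cA := @continuous_sinM R (c / 2) x.
  have cB := @continuous_sinM R ((1 - c) / 2) x.
  have cS := @continuous_sinM R 2^-1 x.
  have cA' := @continuous_cosM R (c / 2) x.
  have cB' := @continuous_cosM R ((1 - c) / 2) x.
  have cS' := @continuous_cosM R 2^-1 x.
  rewrite /continuous_at /g'; apply: cvgB; apply: cvgM.
  - apply: cvgM; first exact: cvg_cst.
    by apply: cvgD; apply: cvgM => //; apply: cvgM => //; exact: cvg_cst.
  - by apply: cvgV => //; rewrite gt_eqF.
  - apply: cvgM; last by apply: cvgV => //; rewrite gt_eqF.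
    apply: cvgM; last by apply: cvgM; [exact: cvg_cst|exact: cS'].
    by apply: cvgM; [apply: cvgM; [exact: cvg_cst|exact: cA]|exact: cB].
  - by apply: cvgV => //; rewrite gt_eqF.
have [C HC] := Riemann_Lebesgue_C1 epi dg cg'.
exists C => n.
have iC (f : R -> R) a b : continuous f -> leb.-integrable `[a, b] (EFin \o f).
  by move=> cf; apply: continuous_integrable_itv; exact: continuous_subspaceT.
have cd : continuous (fun x => dkernel c n.+1 x - dkernel 0 n.+1 x).
  by move=> x; apply: continuousB; exact: continuous_dkernel.
rewrite -[X in _ - X](Rintegral_dkernel0 n) -RintegralB//; last 2 first.
- exact/iC/continuous_dkernel.
- exact/iC/continuous_dkernel.
rewrite (Rintegral_itv_split (ltW e0) (ltW epi) cd) [X in _ <= X]addrC.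
apply: le_trans (ler_normD _ _) _; apply: lerD.
  rewrite -[X in 2 * X]subr0; apply: normr_Rintegral_itv_le; first exact: ltW.
    exact: continuous_subspaceT.
  move=> x; rewrite in_itv/= => /andP[x0 xe].
  by apply: dkernel_diff_le2; rewrite // x0 (le_trans xe)// ltW.
rewrite (_ : \int[leb]_(x in _) _ = \int[leb]_(x in `[e, pi]) (g x * sin (n.+1%:R * x)))//.
apply: eq_Rintegral => x; rewrite inE/= in_itv/= => /andP[ex xpi].
by rewrite dkernel_diff// xpi (lt_le_trans e0).
Qed.

Let q n x : R := expR (- ((n%:R + c) * x)) + expR (- ((n%:R + (1 - c)) * x)).
(** [j 0] is the integrand of [egammaM_exp], and [j n] is [j 0] times e^(-n x). *)
Let j n x : R := q n x / (1 + expR (- x)).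

Let measurable_expN (k : R) (D : set R) : measurable_fun D (fun x => expR (- (k * x))).
Proof.
apply: measurable_funTS; apply: measurableT_comp => //.
by apply: measurableT_comp => //; exact: measurable_funM.
Qed.

Let integral_q n : (\int[leb]_(x in `[0%R, +oo[) (q n x)%:E = (Q n)%:E)%E.
Proof.
under eq_integral do rewrite EFinD.
rewrite ge0_integralD//=; last 2 first.
- by apply/measurable_EFinP; exact: measurable_expN.
- by apply/measurable_EFinP; exact: measurable_expN.
by rewrite (integral_expRN (ltr_wpDl (ler0n _ n) c0))
  (integral_expRN (ltr_wpDl (ler0n _ n) c1)).
Qed.

Let q_ge0 n x : 0 <= q n x.
Proof. by rewrite addr_ge0 ?expR_ge0. Qed.

Let j_ge0 n x : 0 <= j n x.
Proof. by rewrite divr_ge0 ?addr_ge0 ?expR_ge0. Qed.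

Let j_le n x : j n x <= q n x.
Proof.
by rewrite /j ler_pdivrMr ?ltr_pwDl ?expR_ge0// ler_peMr// lerDl expR_ge0.
Qed.

Let measurable_q n (D : set R) : measurable_fun D (q n).
Proof. by apply: measurable_funD; exact: measurable_expN. Qed.

Let measurable_j n (D : set R) : measurable_fun D (j n).
Proof.
apply: measurable_funM => //.
apply: measurable_funTS; apply: continuous_measurable_fun => x.
apply: cvgV; first by rewrite gt_eqF// addr_gt0// expR_gt0.
apply: cvgD; first exact: cvg_cst.
apply: (@continuous_comp _ _ _ -%R expR); last exact: continuous_expR.
by apply: continuousN; exact: cvg_id.
Qed.

Let integrable_j n : leb.-integrable `[0%R, +oo[ (EFin \o j n).
Proof.
apply/integrableP; split; first by apply/measurable_EFinP; exact: measurable_j.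
apply: (@le_lt_trans _ _ (Q n)%:E); last exact: ltry.
rewrite -integral_q; apply: ge0_le_integral => //=.
- by apply/measurable_EFinP; apply: measurableT_comp => //; exact: measurable_j.
- by apply/measurable_EFinP; exact: measurable_q.
- by move=> x _; rewrite lee_fin ger0_norm.
Qed.

Let J n : R := \int[leb]_(x in `[0%R, +oo[) j n x.

Let J_ge0 n : 0 <= J n.
Proof. by apply: Rintegral_ge0 => x _. Qed.

(* Replaces the expansion of [1 / (1 + expR (- x))] into a geometric series. *)
Let JD n : J n + J n.+1 = Q n.
Proof.
rewrite -RintegralD//.
rewrite /Rintegral -[RHS]/(fine (Q n)%:E) -integral_q; congr fine.
apply: eq_integral => x _; congr EFin.
rewrite /j /q -mulrDl.
have E k : expR (- ((n.+1%:R + k) * x)) = expR (- ((n%:R + k) * x)) * expR (- x).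
  by rewrite -expRD -natr1; congr expR; ring.
by rewrite !E -mulrDl -[X in (X + _) / _]mulr1 -mulrDr mulfK.
Qed.

Let J_le n : J n <= Q n.
Proof. by rewrite -JD lerDl. Qed.

(** Iterating [JD] expands [J 0] into the alternating partial sum with exact remainder [J n], which
    tends to 0 by [J_le] and [Q_le]. *)
Let J0E n : J 0 = \sum_(k < n) (-1) ^+ k * Q k + (-1) ^+ n * J n.
Proof.
elim: n => [|n IHn]; first by rewrite big_ord0 add0r expr0 mul1r.
by rewrite big_ord_recr /= IHn -(JD n) exprS mulN1r mulNr mulrDr addrA addrK.
Qed.

Lemma reflection_integral : sin (pi * c) * J 0 = pi.
Proof.
apply/eqP; rewrite -subr_eq0 -normr_le0; apply/ler_addgt0Pr => d d0; rewrite add0r.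
have pi0 := @pi_gt0 R.
(* The bound d/4 makes the contribution 2e of [0, e] at most d/2; the bound pi/2 keeps e below
   pi. *)
pose e : R := Num.min (d / 4) (pi / 2).
have e0 : 0 < e by rewrite lt_min !divr_gt0.
have epi : e < pi by rewrite gt_min; apply/orP; right; lra.
have ed : 2 * e <= d / 2.
  by have : e <= d / 4 by [rewrite /e ge_min lexx]; lra.
have [C HC] := @dkernel_integral_cvg e (introT andP (conj e0 epi)).
(* Large enough for the remaining half of d: [C] comes from Riemann-Lebesgue and 2 from the bound
   [Q_le] on the remainder of the series. *)
pose n := Num.trunc (2 * `|C + 2| / d).
have nP : (C + 2) / n.+1%:R <= d / 2.
  rewrite ler_pdivrMr//; apply: le_trans (ler_norm _) _.
  have : 2 * `|C + 2| / d < n.+1%:R by exact: truncnS_gt.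
  by rewrite ltr_pdivrMr// => H; lra.
have -> : sin (pi * c) * J 0 - pi =
    (\int[leb]_(x in `[0, pi]) dkernel c n.+1 x - pi) +
    sin (pi * c) * ((-1) ^+ n.+1 * J n.+1).
  by rewrite Rintegral_dkernel_sin// (J0E n.+1) mulrDr addrAC.
apply: le_trans (ler_normD _ _) _.
have H1 := HC n.
have H2 : `|sin (pi * c) * ((-1) ^+ n.+1 * J n.+1)| <= 2 / n.+1%:R.
  rewrite !normrM normrX normrN1 expr1n mul1r (ger0_norm (J_ge0 _)).
  apply: le_trans (Q_le n); apply: le_trans (J_le n.+1).
  by rewrite ler_piMl// sin_max.
apply: le_trans (lerD H1 H2) _; move: nP; rewrite mulrDl.
by move: (C / _) (2 / _) => X Y nP; lra.
Qed.

Lemma egammaM_sin :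
  (egamma (c - 1) * egamma (- c) = (pi / sin (pi * c))%:E)%E.
Proof.
have s0 := sin_piM_gt0 c01.
rewrite egammaM_exp// -[X in (X / _)%:E]reflection_integral mulrAC mulfV ?gt_eqF// mul1r.
rewrite /J /Rintegral fineK; last exact: integrable_fin_num (integrable_j 0).
by apply: eq_integral => x _; rewrite /j /q !add0r.
Qed.

End reflection.

(** * Representation of the history part *)

Lemma measurable_fun_fst_on d1 d2 d3 (T1 : measurableType d1) (T2 : measurableType d2)
    (T3 : measurableType d3) (A : set T1) (B : set T2) (p : T1 -> T3) :
  measurable A -> measurable_fun A p -> measurable_fun (A `*` B) (fun z => p z.1).
Proof.
move=> mA mp; apply: (measurable_comp mA _ mp); first by move=> _ [z [Az _] <-].
exact: measurable_funTS measurable_fst.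
Qed.

Lemma measurable_fun_snd_on d1 d2 d3 (T1 : measurableType d1) (T2 : measurableType d2)
    (T3 : measurableType d3) (A : set T1) (B : set T2) (p : T2 -> T3) :
  measurable B -> measurable_fun B p -> measurable_fun (A `*` B) (fun z => p z.2).
Proof.
move=> mB mp; apply: (measurable_comp mB _ mp); first by move=> _ [z [_ Bz] <-].
exact: measurable_funTS measurable_snd.
Qed.

Section representation.
Context {R : realType}.
Notation leb := (@lebesgue_measure R).

(** Two nonnegative extended reals with a finite positive product are both finite and positive: a
    factor +oo would make the product +oo or, against 0, equal to 0. *)
Lemma Gamma_reflection (alpha : R) : 0 < alpha < 1 ->
  exists g : R, [/\ egamma (- alpha) = g%:E, 0 < g & c_ alpha * g = (Gamma alpha)^-1].
Proof.
move=> a01; have := egammaM_sin a01; rewrite /c_ GammaE.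
have s0 := sin_piM_gt0 a01.
have := egamma_ge0 (alpha - 1); have := egamma_ge0 (- alpha).
have P0 : 0 < pi / sin (pi * alpha) :> R by rewrite divr_gt0// pi_gt0.
case: (egamma (alpha - 1)) => [u||]//; case: (egamma (- alpha)) => [v||]//.
- rewrite !lee_fin => v0 u0 /= [E]; exists v; split => //.
    rewrite lt_neqAle v0 andbT; apply/eqP => v0'.
    by move: P0; rewrite -E -v0' mulr0 ltxx.
  have uv0 : u * v != 0 by rewrite E gt_eqF.
  have : u != 0 by apply: contra uv0 => /eqP ->; rewrite mul0r.
  move=> un0; apply: (mulfI un0); rewrite mulfV// mulrCA E.
  by rewrite mulrA divfK ?mulfV ?(gt_eqF s0) ?(gt_eqF (pi_gt0 R)).
- rewrite lee_fin => _; rewrite le_eqVlt => /predU1P[<-|u0].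
    by rewrite mul0e => -[E]; rewrite -E ltxx in P0.
  by rewrite gt0_muley.
- move=> + _; rewrite lee_fin le_eqVlt => /predU1P[<-|v0].
    by rewrite mule0 => -[E]; rewrite -E ltxx in P0.
  by rewrite gt0_mulye.
Qed.

Variables (a b : R) (f : R -> R) (alpha : R) (Omega : set R) (psi : R -> R) (h t : R).
Hypotheses (cf : {within `[a, b], continuous f}) (a01 : 0 < alpha < 1).
Hypotheses (psiP : increasing_C1_onto Omega psi) (h0 : 0 < h).
Hypothesis tab : t \in `[a + h, b].

Let aT : a <= t - h.
Proof. by have := shift_itv h0 tab; rewrite in_itv/= => /andP[]. Qed.

Let cfT : {within `[a, t - h], continuous f}.
Proof.
apply: continuous_subspaceW cf; apply: subset_itvl; rewrite bnd_simp.
by have := shift_itv h0 tab; rewrite in_itv/= => /andP[].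
Qed.

Let t_gt tau : tau \in `[a, t - h] -> 0 < t - tau.
Proof.
rewrite in_itv/= => /andP[_ tauT]; rewrite subr_gt0; apply: le_lt_trans tauT _.
by rewrite ltrBlDr ltrDl.
Qed.

Let K (r : R) := psi r `^ (- alpha) * derive1 psi r.
Let F (z : R * R) : R := K z.1 * (expR (- ((t - z.2) * psi z.1)) * f z.2).

Let oO : open Omega. Proof. by have [[]] := psiP. Qed.
Let psi0 r : Omega r -> 0 < psi r. Proof. by have [_ + _ _ _] := psiP; apply. Qed.
Let Cpsi : Cn 1 Omega psi. Proof. by have [] := psiP. Qed.
Let mO : measurable (Omega : set (measurableTypeR R)).
Proof. exact: open_measurable. Qed.
Let mB : measurable (`[a, t - h]%classic : set (measurableTypeR R)).
Proof. exact: measurable_itv. Qed.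

Let measurable_Cn0 D (g : R -> R) : measurable (D : set (measurableTypeR R)) ->
  Cn 0 D g -> measurable_fun D g.
Proof. by move=> mD cg; exact: subspace_continuous_measurable_fun. Qed.

Let measurable_K : measurable_fun Omega K.
Proof.
apply: measurable_Cn0 => //; apply: Cn_M; first by apply: Cn_powR_comp => //; exact: CnS.
exact: Cn_derive1.
Qed.

Let measurable_F : measurable_fun (Omega `*` `[a, t - h]) F.
Proof.
apply: measurable_funM.
  exact: (@measurable_fun_fst_on _ _ _ (measurableTypeR R) (measurableTypeR R)).
apply: measurable_funM; last first.
  apply: (@measurable_fun_snd_on _ _ _ (measurableTypeR R) (measurableTypeR R)) => //.
  exact: measurable_Cn0.
apply: measurableT_comp => //; apply: measurableT_comp => //; apply: measurable_funM.
  apply: measurable_funB => //.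
  exact: measurable_funTS measurable_snd.
apply: (@measurable_fun_fst_on _ _ _ (measurableTypeR R) (measurableTypeR R)) => //.
by apply: measurable_Cn0 => //; exact: CnS.
Qed.

Let K_ge0 r : Omega r -> 0 <= K r.
Proof.
by move=> Or; rewrite mulr_ge0 ?powR_ge0// (increasing_C1_onto_derive1_ge0 psiP).
Qed.

Let continuous_kernel :
  {within `[a, t - h], continuous (fun tau => (t - tau) `^ (alpha - 1))}.
Proof.
apply: (@Cn_powR_comp _ 0) => [tau|]; first exact: t_gt.
apply: continuous_subspaceT => tau; apply: cvgB; last exact: cvg_id.
exact: cvg_cst.
Qed.

Let integral_K tau (g : R) : egamma (- alpha) = g%:E -> tau \in `[a, t - h] ->
  (\int[leb]_(r in Omega) (K r * expR (- ((t - tau) * psi r)))%:E =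
   ((t - tau) `^ (alpha - 1) * g)%:E)%E.
Proof.
move=> gE /t_gt tt; have := @integral_psi_powR_exp _ Omega psi (- alpha) _ psiP tt.
rewrite gE opprK -EFinM => <-.
by apply: eq_integral => r _; rewrite /K mulrAC.
Qed.

Let measurable_Kexp tau : measurable_fun Omega (fun r => K r * expR (- ((t - tau) * psi r))).
Proof.
apply: measurable_funM => //; apply: measurableT_comp => //.
apply: measurableT_comp => //; apply: measurable_funM => //.
by apply: measurable_Cn0 => //; exact: CnS.
Qed.

Let integral_F tau g : egamma (- alpha) = g%:E -> tau \in `[a, t - h] ->
  (\int[leb]_(r in Omega) (F (r, tau))%:E =
   ((t - tau) `^ (alpha - 1) * g * f tau)%:E)%E.
Proof.
move=> gE taut; rewrite EFinM -(integral_K gE taut) -integralZr//.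
  by apply: eq_integral => r _; rewrite -EFinM /F/= mulrA.
apply/integrableP; split; first by apply/measurable_EFinP; exact: measurable_Kexp.
apply: (@le_lt_trans _ _ ((t - tau) `^ (alpha - 1) * g)%:E); last exact: ltry.
rewrite -(integral_K gE taut) le_eqVlt; apply/orP; left; apply/eqP.
apply: eq_integral => r; rewrite inE => Or /=.
by rewrite ger0_norm// mulr_ge0 ?expR_ge0 ?K_ge0.
Qed.

Let integral_normF tau g : egamma (- alpha) = g%:E -> tau \in `[a, t - h] ->
  (\int[leb]_(r in Omega) (`|F (r, tau)|)%:E =
   ((t - tau) `^ (alpha - 1) * g * `|f tau|)%:E)%E.
Proof.
move=> gE taut; rewrite EFinM -(integral_K gE taut) -ge0_integralZr//=; last 2 first.
- by apply/measurable_EFinP; exact: measurable_Kexp.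
- by move=> r Or; rewrite lee_fin mulr_ge0 ?expR_ge0 ?K_ge0.
apply: eq_integral => r; rewrite inE => Or; rewrite -EFinM /F/= mulrA normrM.
by rewrite ger0_norm// mulr_ge0 ?expR_ge0 ?K_ge0.
Qed.

(** The inner integral of the absolute value is exact by [integral_normF], since only the sign of
    [f tau] can vary. What remains is a continuous function of tau on a segment, as t - tau is at
    least h there. *)
Let F_lty : (\int[leb]_(tau in `[a, (t - h)%R])
  \int[leb]_(r in Omega) (`|F (r, tau)|)%:E < +oo)%E.
Proof.
have [g [gE g0 _]] := Gamma_reflection a01.
have : leb.-integrable `[a, t - h]
    (EFin \o (fun tau => (t - tau) `^ (alpha - 1) * g * `|f tau|)).
  apply: continuous_integrable_itv; apply: (@Cn_M _ 0).
    by apply: (@Cn_M _ 0); [exact: continuous_kernel|exact: Cn_cst].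
  exact: within_continuous_norm.
move=> /integrableP[_]; apply: le_lt_trans.
rewrite le_eqVlt; apply/orP; left; apply/eqP; apply: eq_integral => tau.
rewrite inE => taut; rewrite (integral_normF gE)//=; congr EFin.
by rewrite [RHS]ger0_norm// !mulr_ge0 ?powR_ge0// ltW.
Qed.

Let muF r : (mu_ a f alpha psi t h r)%:E =
  ((c_ alpha)%:E * \int[leb]_(tau in `[a, (t - h)%R]) (F (r, tau))%:E)%E.
Proof.
have cE : {within `[a, t - h], continuous (fun tau => expR (- ((t - tau) * psi r)) * f tau)}.
  apply: (@Cn_M _ 0 _ (fun tau => expR (- ((t - tau) * psi r)))) => //.
  apply: continuous_subspaceT => x; apply: continuous_comp; last exact: continuous_expR.
  apply: cvgN; apply: cvgM; last exact: cvg_cst.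
  by apply: cvgB; [exact: cvg_cst|exact: cvg_id].
have iE := continuous_integrable_itv cE.
rewrite /F/=; under eq_integral do rewrite EFinM.
rewrite integralZl// -[X in (_ * (_ * X))%E]fineK; last exact: integrable_fin_num.
have -> : mu_ a f alpha psi t h r = c_ alpha * derive1 psi r * psi r `^ (- alpha) *
    \int[leb]_(tau in `[a, t - h]) (expR (- ((t - tau) * psi r)) * f tau).
  by congr (_ * _); apply: eq_Rintegral => tau _; rewrite mulNr.
rewrite -!EFinM /Rintegral /K; congr EFin; move: (fine _) => I; ring.
Qed.

Lemma integrable_mu : leb.-integrable Omega (fun r => (mu_ a f alpha psi t h r)%:E).
Proof.
under eq_fun do rewrite muF; apply: integrableZl => //.
exact: (integrable_fubini_on (m1 := leb) (m2 := leb) mO mB measurable_F F_lty).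
Qed.

Lemma history_mu : history a f alpha h t =
  \int[leb]_(r in Omega) mu_ a f alpha psi t h r.
Proof.
have [g [gE g0 cgE]] := Gamma_reflection a01.
rewrite /Rintegral; under [in RHS]eq_integral do rewrite muF.
rewrite integralZl//; last first.
  exact: (integrable_fubini_on (m1 := leb) (m2 := leb) mO mB measurable_F F_lty).
rewrite (fubini_on mO mB measurable_F F_lty).
have ck : {within `[a, t - h], continuous (fun tau => (t - tau) `^ (alpha - 1) * f tau)}.
  exact: (@Cn_M _ 0 _ (fun tau => (t - tau) `^ (alpha - 1))).
have ik := continuous_integrable_itv ck.
have -> : (\int[leb]_(y in `[a, (t - h)%R]) \int[leb]_(x in Omega) (F (x, y))%:E =
    g%:E * \int[leb]_(tau in `[a, (t - h)%R]) ((t - tau) `^ (alpha - 1) * f tau)%:E)%E.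
  rewrite -integralZl//; apply: eq_integral => tau; rewrite inE => taut.
  by rewrite (integral_F gE)// -EFinM; congr EFin; ring.
rewrite muleA -EFinM cgE /history fineM//=.
exact: integrable_fin_num.
Qed.

End representation.

(** * Growth bounds *)

Section bounds.
Context {R : realType}.
Notation leb := (@lebesgue_measure R).

Lemma toward_all (Omega : set R) (e : \bar R) (P : R -> Prop) :
  (forall r, Omega r -> P r) -> \forall r \near toward Omega e, P r.
Proof. by move=> OP; exists setT => [|r [/OP]//]; exact: filterT. Qed.

Lemma c_gt0 (alpha : R) : 0 < alpha < 1 -> 0 < c_ alpha.
Proof. by move=> a01; rewrite /c_ divr_gt0 ?pi_gt0// sin_piM_gt0. Qed.

Lemma Rintegral_expM_le (a b k : R) : a <= b -> 0 < k ->
  \int[leb]_(x in `[a, b]) expR (k * x) <= expR (k * b) / k.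
Proof.
rewrite le_eqVlt => /predU1P[<- k0|ab k0].
  by rewrite set_itv1 Rintegral_set1 divr_ge0 ?expR_ge0 ?ltW.
have dF x : x \in `[a, b] -> is_derive x (1 : R) (fun x => k^-1 * expR (k * x)) (expR (k * x)).
  move=> _; have H := is_derive_expM k x.
  by apply: trigger_derive; rewrite /GRing.scale/= mulKf ?gt_eqF.
rewrite (Rintegral_FTC2 ab dF); last first.
  exact: (derivative_on_continuous (@derivative_on_expM _ _ k)).
by rewrite mulrC gerBl mulr_ge0 ?expR_ge0// invr_ge0 ltW.
Qed.

Variables (a b : R) (f : R -> R) (alpha : R) (Omega : set R) (psi : R -> R) (h t : R).
Hypotheses (cf : {within `[a, b], continuous f}) (a01 : 0 < alpha < 1).
Hypotheses (psiP : increasing_C1_onto Omega psi) (h0 : 0 < h).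
Hypothesis tab : t \in `[a + h, b].

Let aT : a <= t - h.
Proof. by have := shift_itv h0 tab; rewrite in_itv/= => /andP[]. Qed.

Let Tb : t - h <= b.
Proof. by have := shift_itv h0 tab; rewrite in_itv/= => /andP[]. Qed.

Let sub_itv tau : tau \in `[a, t - h] -> tau \in `[a, b].
Proof. by rewrite !in_itv/= => /andP[-> tauT]; exact: le_trans Tb. Qed.

Let cE r : {within `[a, t - h], continuous (fun tau => expR (- (t - tau) * psi r))}.
Proof.
apply: continuous_subspaceT => x; apply: continuous_comp; last exact: continuous_expR.
apply: cvgM; last exact: cvg_cst.
by apply: cvgN; apply: cvgB; [exact: cvg_cst|exact: cvg_id].
Qed.

Let cEf r : {within `[a, t - h], continuous (fun tau => expR (- (t - tau) * psi r) * f tau)}.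
Proof.
apply: (@Cn_M _ 0); first exact: cE.
by apply: continuous_subspaceW cf => tau; exact: sub_itv.
Qed.

Let norm_mu_le r (B : R) : Omega r ->
  `|\int[leb]_(tau in `[a, t - h]) (expR (- (t - tau) * psi r) * f tau)| <= B ->
  `|mu_ a f alpha psi t h r| <= c_ alpha * derive1 psi r * psi r `^ (- alpha) * B.
Proof.
move=> Or IB.
have K0 : 0 <= c_ alpha * derive1 psi r * psi r `^ (- alpha).
  have d0 := increasing_C1_onto_derive1_ge0 psiP Or.
  by apply: mulr_ge0 (powR_ge0 _ _); apply: mulr_ge0 d0; exact/ltW/c_gt0.
by rewrite /mu_ normrM (ger0_norm K0) ler_wpM2l.
Qed.

(** With |f| bounded by M, the integral of e^(-(t - tau) psi) up to t - h is at most e^(-h psi) /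
    psi, which supplies both the extra power of psi and the exponential. The estimate holds on all
    of Omega, hence near its upper end. *)
Lemma mu_bound_sup : exists2 C : R, 0 < C & forall r, Omega r ->
  `|mu_ a f alpha psi t h r| <=
  C * derive1 psi r * psi r `^ (- alpha - 1) * expR (- h * psi r).
Proof.
have [M M0 fM] := continuous_bounded_itv (le_trans aT Tb) cf.
exists (c_ alpha * M) => [|r Or]; first by rewrite (mulr_gt0 (c_gt0 a01)).
have psi0 : 0 < psi r by have [_ + _ _ _] := psiP; apply.
have -> : c_ alpha * M * derive1 psi r * psi r `^ (- alpha - 1) * expR (- h * psi r) =
    c_ alpha * derive1 psi r * psi r `^ (- alpha) * (M * (expR (- h * psi r) / psi r)).
  rewrite powRD ?(gt_eqF psi0) ?implybT// -[- 1]/(- (1)) powR_inv1 ?ltW//; ring.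
apply: norm_mu_le => //.
have mab : measurable (`[a, t - h]%classic : set (measurableTypeR R)) by exact: measurable_itv.
have iE := continuous_integrable_itv (cE (r := r)).
apply: le_trans (le_normr_Rintegral mab (continuous_integrable_itv (cEf (r := r)))) _.
have EE tau : expR (- (t - tau) * psi r) = expR (- t * psi r) * expR (psi r * tau).
  by rewrite -expRD; congr expR; ring.
apply: (@le_trans _ _ (M * \int[leb]_(tau in `[a, t - h]) expR (- (t - tau) * psi r))).
  rewrite -RintegralZl//; apply: le_Rintegral => //.
  - by apply: continuous_integrable_itv; apply: within_continuous_norm; exact: cEf.
  - by apply: continuous_integrable_itv; exact: (@Cn_Z _ 0 _ M _ (cE (r := r))).
  - move=> tau /sub_itv/fM fMt; rewrite normrM ger0_norm ?expR_ge0// mulrC.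
    by rewrite ler_wpM2r// expR_ge0.
rewrite ler_pM2l//; under eq_Rintegral do rewrite EE.
rewrite RintegralZl//; last first.
  apply: continuous_integrable_itv.
  exact: (derivative_on_continuous (@derivative_on_expM _ _ (psi r))).
apply: le_trans (ler_wpM2l (expR_ge0 _) (Rintegral_expM_le aT psi0)) _.
by rewrite mulrA -expRD le_eqVlt; apply/orP; left; apply/eqP; congr (expR _ / _); ring.
Qed.

Lemma mu_bound_inf : exists2 C : R, 0 < C & forall r, Omega r ->
  `|mu_ a f alpha psi t h r| <= C * derive1 psi r * psi r `^ (- alpha).
Proof.
have [M M0 fM] := continuous_bounded_itv (le_trans aT Tb) cf.
(* The added 1 keeps the constant positive at t = a + h, where the segment is a single point. *)
have T0 : 0 < t - h - a + 1 by rewrite ltr_wpDl// subr_ge0.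
exists (c_ alpha * (M * (t - h - a + 1))) => [|r Or].
  by rewrite (mulr_gt0 (c_gt0 a01))// mulr_gt0.
have psi0 : 0 < psi r by have [_ + _ _ _] := psiP; apply.
have -> : c_ alpha * (M * (t - h - a + 1)) * derive1 psi r * psi r `^ (- alpha) =
   c_ alpha * derive1 psi r * psi r `^ (- alpha) * (M * (t - h - a + 1)) by ring.
apply: norm_mu_le => //; apply: (@le_trans _ _ (M * (t - h - a))).
  apply: normr_Rintegral_itv_le => // tau taut.
  rewrite normrM ger0_norm ?expR_ge0// -[leRHS]mul1r ler_pM ?expR_ge0 ?fM//.
    rewrite expR_le1 mulNr oppr_le0 mulr_ge0 ?(ltW psi0)// subr_ge0.
    move: taut; rewrite in_itv/= => /andP[_ tT]; apply: le_trans tT _.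
    by rewrite lerBlDr lerDl ltW.
  exact: sub_itv.
by rewrite ler_pM2l// lerDl.
Qed.

End bounds.

Theorem theorem3 (R : realType) (a b : R) (f : R -> R) (alpha : R)
    (Omega : set R) (psi : R -> R) (h : R) :
  a < b ->
  {within `[a, b], continuous f} ->
  0 < alpha < 1 ->
  open_interval Omega ->
  admissible Omega psi ->
  0 < h < b - a ->
  let mu := mu_ a f alpha psi in
  (* representation of the history part *)
  (forall t, t \in `[a + h, b] ->
     (@lebesgue_measure R).-integrable Omega (fun r => (mu t h r)%:E) /\
     history a f alpha h t = \int[@lebesgue_measure R]_(r in Omega) mu t h r) /\
  [/\ (* (a) *)
      (forall r, Omega r ->
         let F t y := - psi r * y +
           c_ alpha * derive1 psi r * psi r `^ (- alpha) * expR (- h * psi r) *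
           f (t - h) in
         [/\ solves_on `[a + h, b] F (fun t => mu t h r),
             mu (a + h) h r = 0 &
             forall y : R -> R, solves_on `[a + h, b] F y -> y (a + h) = 0 ->
               {in `[a + h, b], forall t, y t = mu t h r}]),
      (* (b) *)
      (forall k : nat, (0 < k)%N -> Cn k Omega psi ->
         forall t, t \in `[a + h, b] -> Cn k.-1 Omega (mu t h)),
      (* (c) *)
      (Cinfty Omega psi ->
         forall t, t \in `[a + h, b] -> Cinfty Omega (mu t h)),
      (* (d) *)
      (forall l : nat, Cn l `[a, b] f ->
         forall r, Omega r -> Cn l.+1 `[a + h, b] (fun t => mu t h r)) &
      (* (e) *)
      (forall t, t \in `[a + h, b] ->
         (exists2 C1 : R, 0 < C1 &
            \forall r \near toward Omega (sup_end Omega),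
              `|mu t h r| <=
              C1 * derive1 psi r * psi r `^ (- alpha - 1) * expR (- h * psi r)) /\
         (exists2 C2 : R, 0 < C2 &
            \forall r \near toward Omega (inf_end Omega),
              `|mu t h r| <= C2 * derive1 psi r * psi r `^ (- alpha)))].
Proof.
move=> ab cf a01 iO psiA /andP[h0 hab] mu.
have psiP := admissible_onto iO psiA; have [[_ oO _] psi0 _ _ _] := psiP.
split.
  move=> t tab; split; first exact: (integrable_mu cf a01 psiP h0 tab).
  exact: (history_mu cf a01 psiP h0 tab).
split.
- move=> r _ F; split.
  + exact: mu_ode.
  + exact: mu_initial.
  + by move=> y dy ya; exact: (mu_ode_unique cf h0 hab dy ya).
- by move=> [//|k] _ Ck t tab; exact: (Cn_mu_parameter alpha cf h0 tab oO psi0 Ck).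
- by move=> Ck t tab n; exact: (Cn_mu_parameter alpha cf h0 tab oO psi0 (Ck n.+1)).
- by move=> l Cl r _; exact: Cn_mu_time.
- move=> t tab; split.
  + have [C C0 HC] := mu_bound_sup cf a01 psiP h0 tab.
    by exists C => //; exact: toward_all.
  + have [C C0 HC] := mu_bound_inf cf a01 psiP h0 tab.
    by exists C => //; exact: toward_all.
Qed.
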